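(* Let $M$ be an oriented Riemannian 4-manifold, let $S_M$ be its unit tangent sphere bundle with the metric described in the context, and let $\phi=\alpha+\mu\wedge\beta-\alpha_2\in\Omega^3(S_M)$ be the canonical $G_2$ structure 3-form. Then $(S_M,\phi)$ is never a $G_2$-manifold; that is, $\phi$ is not parallel for the Levi-Civita connection of $S_M$.
   Context: Setting. $(M,\langle\,,\rangle)$ is a (non-empty) oriented smooth Riemannian 4-manifold with Levi-Civita connection $\nabla$ and volume form $\mathrm{Vol}_M$. $S_M=\{u\in TM:\ \|u\|=1\}$ and $f:S_M\to M$ is the projection. Let $U$ be the tautological section of $f^*TM\to S_M$, $U_u=u$. The vertical bundle $\mathcal V=\ker \mathrm{d}f$ is identified with the subbundle $U^\perp\subset f^*TM$, i.e. $\mathcal V_u=u^\perp\subset T_{f(u)}M$. The Levi-Civita connection gives a splitting $TS_M=\mathcal V\oplus\mathcal H^\nabla$, with $\mathcal H^\nabla=\{X\in TS_M:\ (f^*\nabla)_XU=0\}$, and $\mathcal H^\nabla$ is identified with $f^*TM$ via $\mathrm{d}f$. Write $X=X^v+X^h$ for the decomposition of a vector; $X^v=(f^*\nabla)_XU$. The metric on $S_M$ makes $\mathcal V\perp\mathcal H^\nabla$ and restricts to $f^*\langle\,,\rangle$ on each of $\mathcal H^\nabla\cong f^*TM$ and $\mathcal V\subset f^*TM$. Let $\theta$ be the map $\mathcal H^\nabla\to f^*TM$ given by $\mathrm{d}f$ (regarded as taking values in the copy of $f^*TM$ that contains $\mathcal V$), extended by $0$ on $\mathcal V$. Let $e_0=\theta^tU\in\mathcal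 H^\nabla$ be the horizontal vector field with $\theta e_0=U$. Adapted frames: complete $e_0$ locally to an orthonormal frame $e_0,e_1,e_2,e_3$ of $\mathcal H^\nabla$, direct for the orientation of $M$, and set $e_{i+3}=\theta e_i\in\mathcal V$ for $i=1,2,3$. With dual coframe $e^0,\dots,e^6$ and $e^{ij\cdots}=e^i\wedge e^j\wedge\cdots$, the following are globally defined forms on $S_M$ (independent of the adapted frame): $\mu=e^0$, i.e. $\mu(X)=\langle U,\theta X\rangle$; $\beta=e^{14}+e^{25}+e^{36}$, i.e. $\beta(X,Y)=\langle\theta X,Y^v\rangle-\langle\theta Y,X^v\rangle$; $\alpha=e^{456}$, i.e. $\alpha(X,Y,Z)=\mathrm{Vol}_M(U,X^v,Y^v,Z^v)$; $\alpha_2=e^{126}+e^{234}+e^{315}$. The form $\phi=\alpha+\mu\wedge\beta-\alpha_2$ defines a $G_2$ structure on $S_M$ inducing the metric on $S_M$ for which $\mathcal V\perp\mathcal H^\nabla$ and which restricts to $f^*\langle\,,\rangle$ on each of $\mathcal H^\nabla\cong f^*TM$ and $\mathcal V\subset f^*TM$. A Riemannian 7-manifold with a $G_2$ structure $\phi$ is called a $G_2$-manifold when $\phi$ is parallel for the Levi-Civita connection (equivalently, by a known result, when $\phi$ is harmonic, i.e. $\mathrm{d}\phi=0$ and $\delta\phi=0$). *)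

(* Defs.v *)
From HB Require Import structures.
From mathcomp Require Import all_boot all_order all_algebra.
From mathcomp Require Import all_classical all_reals all_analysis.
From mathcomp Require Import ring lra.

Set Implicit Arguments.
Unset Strict Implicit.
Unset Printing Implicit Defensive.
Import Order.TTheory GRing.Theory Num.Theory.
Import numFieldNormedType.Exports.
Local Open Scope classical_set_scope.
Local Open Scope ring_scope.

Section Calculus.
Variables (R : realType) (n : nat) (V : normedModType R).

Definition partial (a : 'I_n) (f : 'rV[R]_n -> V) (x : 'rV[R]_n) : V :=
  'D_(delta_mx 0 a) f x.

Definition iter_partial (s : seq 'I_n) (f : 'rV[R]_n -> V) : 'rV[R]_n -> V :=
  foldr partial f s.

(* C^oo on the open set W: the partial derivatives of all orders exist and are
   differentiable (hence continuous) on W.  Values of f outside W are junk. *)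
Definition smooth_on (W : set 'rV[R]_n) (f : 'rV[R]_n -> V) : Prop :=
  forall (s : seq 'I_n) (x : 'rV[R]_n), W x -> differentiable (iter_partial s f) x.

End Calculus.

(* A bilinear form on R^n with Gram matrix g; vectors are rows. *)
Definition inner (R : realType) (n : nat) (g : 'M[R]_n) (v w : 'rV[R]_n) : R :=
  (v *m g *m w^T) 0 0.

Section Manifolds.
Variables (R : realType) (n : nat) (M : topologicalType).

Record chart := Chart {
  chart_dom : set M;
  chart_map : M -> 'rV[R]_n;
  chart_inv : 'rV[R]_n -> M
}.

Definition chart_img (c : chart) : set 'rV[R]_n := chart_map c @` chart_dom c.

Definition is_chart (c : chart) : Prop :=
  [/\ open (chart_dom c), open (chart_img c),
      {within chart_dom c, continuous (chart_map c)},
      {within chart_img c, continuous (chart_inv c)} &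
      forall p, chart_dom c p -> chart_inv c (chart_map c p) = p].

Definition transition (c d : chart) : 'rV[R]_n -> 'rV[R]_n :=
  chart_map d \o chart_inv c.

Definition transition_dom (c d : chart) : set 'rV[R]_n :=
  chart_map c @` (chart_dom c `&` chart_dom d).

Record oriented_atlas := OrientedAtlas {
  atlas_index : Type;
  atlas_chart : atlas_index -> chart;
  atlas_chartP : forall i, is_chart (atlas_chart i);
  atlas_cover : forall p, exists i, chart_dom (atlas_chart i) p;
  atlas_smooth : forall i j,
    smooth_on (transition_dom (atlas_chart i) (atlas_chart j))
              (transition (atlas_chart i) (atlas_chart j));
  atlas_oriented : forall i j x,
    transition_dom (atlas_chart i) (atlas_chart j) x ->
    0 < \det ('J (transition (atlas_chart i) (atlas_chart j)) x)
}.

(* metric_mx i x is the Gram matrix, at the point of coordinates x of the i-th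
   chart, of the coordinate fields.  With row vectors, the coordinates of a
   tangent vector change by v |-> v *m 'J (transition _ _) x. *)
Record riemannian_metric (A : oriented_atlas) := RiemannianMetric {
  metric_mx : atlas_index A -> 'rV[R]_n -> 'M[R]_n;
  metric_smooth : forall i,
    smooth_on (chart_img (atlas_chart i)) (metric_mx i);
  metric_sym : forall i x, chart_img (atlas_chart i) x ->
    (metric_mx i x)^T = metric_mx i x;
  metric_posdef : forall i x, chart_img (atlas_chart i) x ->
    forall v, v != 0 -> 0 < inner (metric_mx i x) v v;
  metric_compat : forall i j x,
    transition_dom (atlas_chart i) (atlas_chart j) x ->
    let T := transition (atlas_chart i) (atlas_chart j) in
    metric_mx i x = 'J T x *m metric_mx j (T x) *m ('J T x)^T
}.

End Manifolds.

Section LeviCivita.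
Variables (R : realType) (n : nat).
Implicit Types (g : 'rV[R]_n -> 'M[R]_n) (x : 'rV[R]_n).

Definition dmetric g x (k i j : 'I_n) : R := partial k (fun y => g y i j) x.

(* christoffel g x i j k is the coefficient Gamma^k_ij of the Levi-Civita
   connection of g: nabla_(d_i) d_j = \sum_k Gamma^k_ij d_k; see
   christoffel_levi_civita below. *)
Definition christoffel g x (i j k : 'I_n) : R :=
  2^-1 * \sum_l invmx (g x) k l *
    (dmetric g x i j l + dmetric g x j i l - dmetric g x l i j).

Definition torsion_free (C : 'I_n -> 'I_n -> 'I_n -> R) : Prop :=
  forall i j k, C i j k = C j i k.

Definition metric_connection g x (C : 'I_n -> 'I_n -> 'I_n -> R) : Prop :=
  forall k i j, dmetric g x k i j =
    \sum_l C k i l * g x l j + \sum_l C k j l * g x i l.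

Lemma christoffel_levi_civita g x (C : 'I_n -> 'I_n -> 'I_n -> R) :
  (\forall y \near x, (g y)^T = g y) -> g x \in unitmx ->
  (torsion_free C /\ metric_connection g x C) <->
  (forall i j k, C i j k = christoffel g x i j k).
Proof.
move=> gsym gunit.
have gxsym i j : g x i j = g x j i.
  by rewrite -{1}(nbhs_singleton gsym) mxE.
have dsym k i j : dmetric g x k i j = dmetric g x k j i.
  apply: near_eq_derive.
  by move: gsym; apply: filterS => y gy; rewrite -{1}gy mxE.
pose B i j l := dmetric g x i j l + dmetric g x j i l - dmetric g x l i j.
have lower i j m : \sum_k christoffel g x i j k * g x k m = 2^-1 * B i j m.
  rewrite /christoffel.
  under eq_bigr do rewrite -mulrA mulr_suml.
  rewrite -mulr_sumr exchange_big /=; congr (_ * _).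
  under eq_bigr => l _.
    rewrite (_ : \sum_k _ = B i j l * (l == m)%:R); last first.
      transitivity (B i j l * \sum_k g x m k * invmx (g x) k l).
        rewrite mulr_sumr; apply: eq_bigr => k _.
        by rewrite (gxsym k m) /B; ring.
      have := congr1 (fun A : 'M[R]_n => A m l) (mulmxV gunit).
      by rewrite !mxE => ->; rewrite eq_sym.
    over.
  rewrite (bigD1 m)//= eqxx mulr1 big1 ?addr0// => l /negPf ->.
  by rewrite mulr0.
split => [[Ct Cm] i j k|CE].
- have Cl m : \sum_l C i j l * g x l m = 2^-1 * B i j m.
    have E1 := Cm i j m; have E2 := Cm j i m; have E3 := Cm m i j.
    set a := \sum_l C i j l * g x l m.
    rewrite /B E1 E2 E3.
    rewrite (_ : \sum_l C j i l * g x l m = a); last first.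
      by apply: eq_bigr => l _; rewrite Ct.
    rewrite (_ : \sum_l C m i l * g x l j = \sum_l C i m l * g x j l); last first.
      by apply: eq_bigr => l _; rewrite Ct gxsym.
    rewrite (_ : \sum_l C m j l * g x i l = \sum_l C j m l * g x i l); last first.
      by apply: eq_bigr => l _; rewrite Ct.
    by rewrite -/a; field.
  pose c := \row_l C i j l; pose d := \row_l christoffel g x i j l.
  suff : c = d by move=> /rowP/(_ k); rewrite !mxE.
  have : c *m g x = d *m g x.
    apply/rowP => m; rewrite !mxE.
    under eq_bigr do rewrite mxE.
    by rewrite Cl -lower; apply: eq_bigr => l _; rewrite mxE.
  by move=> /(congr1 (mulmx^~ (invmx (g x)))); rewrite !mulmxK.
- split=> [i j k|k i j].
    rewrite !CE /christoffel; congr (_ * _); apply: eq_bigr => l _.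
    by rewrite (dsym l i j); ring.
  under eq_bigr do rewrite CE.
  under [X in _ = _ + X]eq_bigr do rewrite CE gxsym.
  rewrite !lower /B (dsym i k j) (dsym j k i) (dsym k j i); by field.
Qed.

(* Components (nabla_(d_a) T)(d_b, d_c, d_d) for the Levi-Civita connection
   of g and a covariant 3-tensor T with components T x b c d. *)
Definition covariant_derivative g (T : 'rV[R]_n -> 'I_n -> 'I_n -> 'I_n -> R)
    x (a b c d : 'I_n) : R :=
  partial a (fun y => T y b c d) x
  - \sum_l christoffel g x a b l * T x l c d
  - \sum_l christoffel g x a c l * T x b l d
  - \sum_l christoffel g x a d l * T x b c l.

Definition parallel_on (W : set 'rV[R]_n) g
    (T : 'rV[R]_n -> 'I_n -> 'I_n -> 'I_n -> R) : Prop :=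
  forall x, W x -> forall a b c d, covariant_derivative g T x a b c d = 0.

End LeviCivita.

(* The volume form of the metric with Gram matrix g, in a positive chart. *)
Definition vol4 (R : realType) (g : 'M[R]_4) (a b c d : 'rV[R]_4) : R :=
  Num.sqrt (\det g) *
  \det (\matrix_(i < 4, j < 4) (nth 0 [:: a; b; c; d] i) 0 j).

(* Geometry of S_M at the unit vector of coordinates u at the point of
   coordinates x.  A tangent vector X of the total space of TM at (x, u) is the
   pair of the velocities of the point and of the components of the vector. *)
Section SphereBundleAlgebra.
Variables (R : realType) (g : 'rV[R]_4 -> 'M[R]_4) (x u : 'rV[R]_4).
Implicit Types X Y Z : 'rV[R]_4 * 'rV[R]_4.

Definition theta X : 'rV[R]_4 := X.1.

(* X^v = (f^* nabla)_X U *)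
Definition vert X : 'rV[R]_4 :=
  X.2 + \row_k \sum_i \sum_j christoffel g x i j k * X.1 0 i * u 0 j.

Definition sphere_metric X Y : R :=
  inner (g x) (theta X) (theta Y) + inner (g x) (vert X) (vert Y).

Definition mu X : R := inner (g x) u (theta X).

Definition beta X Y : R :=
  inner (g x) (theta X) (vert Y) - inner (g x) (theta Y) (vert X).

Definition alpha X Y Z : R := vol4 (g x) u (vert X) (vert Y) (vert Z).

(* e^126 + e^234 + e^315 in every adapted frame: see alpha2E below. *)
Definition alpha2 X Y Z : R :=
  vol4 (g x) u (theta X) (theta Y) (vert Z) +
  vol4 (g x) u (theta Y) (theta Z) (vert X) +
  vol4 (g x) u (theta Z) (theta X) (vert Y).

Definition mu_wedge_beta X Y Z : R :=
  mu X * beta Y Z + mu Y * beta Z X + mu Z * beta X Y.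

Definition phi X Y Z : R := alpha X Y Z + mu_wedge_beta X Y Z - alpha2 X Y Z.

(* X is tangent to S_M: its vertical part is in u^\perp. *)
Definition sphere_tangent X : Prop := inner (g x) u (vert X) = 0.

(* The rows of E are theta e_0 = u, theta e_1, theta e_2, theta e_3. *)
Definition adapted_frame (E : 'M[R]_4) : Prop :=
  [/\ row 0 E = u, E *m g x *m E^T = 1%:M & 0 < \det E].

(* The dual coframe e^0, ..., e^6 of the adapted frame. *)
Definition coframe (E : 'M[R]_4) (k : nat) X : R :=
  if (k < 4)%N then inner (g x) (theta X) (row (inord k) E)
  else inner (g x) (vert X) (row (inord (k - 3)) E).

(* e^ij and e^ijk *)
Definition wedge2 (E : 'M[R]_4) (i j : nat) X Y : R :=
  \det (\matrix_(r < 2, s < 2)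
     coframe E (nth 0%N [:: i; j] r) (nth X [:: X; Y] s)).

Definition wedge3 (E : 'M[R]_4) (i j k : nat) X Y Z : R :=
  \det (\matrix_(r < 3, s < 3)
     coframe E (nth 0%N [:: i; j; k] r) (nth X [:: X; Y; Z] s)).

Lemma inner_row (E : 'M[R]_4) (z : 'rV[R]_4) i :
  inner (g x) z (row i E) = (z *m g x *m E^T) 0 i.
Proof. by rewrite /inner !mxE; apply: eq_bigr => j _; rewrite !mxE. Qed.

Lemma inner_sum_frame (E : 'M[R]_4) (v w : 'rV[R]_4) :
  (g x)^T = g x -> E *m g x *m E^T = 1%:M ->
  inner (g x) v w =
  \sum_i inner (g x) v (row i E) * inner (g x) w (row i E).
Proof.
move=> gsym EgE.
have EgE' : g x *m E^T *m E = 1%:M by apply: mulmx1C; rewrite mulmxA.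
under eq_bigr do rewrite !inner_row.
rewrite /inner.
have -> : v *m g x *m w^T = (v *m g x *m E^T) *m (w *m g x *m E^T)^T.
  rewrite !trmx_mul trmxK gsym !mulmxA.
  by rewrite -(mulmxA v (g x) E^T) -(mulmxA v _ E) EgE' mulmx1.
by rewrite mxE; apply: eq_bigr => i _; congr (_ * _); rewrite mxE.
Qed.

Lemma vol4_frame (E : 'M[R]_4) (a b c d : 'rV[R]_4) :
  E *m g x *m E^T = 1%:M -> 0 < \det E -> 0 < \det (g x) ->
  vol4 (g x) a b c d =
  \det (\matrix_(r < 4, i < 4) inner (g x) (nth 0 [:: a; b; c; d] r) (row i E)).
Proof.
move=> EgE detE detg.
have detEg : Num.sqrt (\det (g x)) = \det (g x) * \det E.
  have := congr1 determinant EgE; rewrite !det_mulmx det_tr det1.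
  have := sqr_sqrtr (ltW detg); have := detg; rewrite -sqrtr_gt0.
  set r := Num.sqrt _ => r0 <- h.
  suff rE : r * \det E = 1 by rewrite expr2 -mulrA rE mulr1.
  apply/eqP; rewrite -(@eqrXn2 _ 2) ?ler01//; last by rewrite mulr_ge0// ltW.
  by rewrite expr1n -h; apply/eqP; ring.
rewrite /vol4 detEg.
set W := (X in _ * _ * \det X = _).
have -> : (\matrix_(r, i) inner (g x) (nth 0 [:: a; b; c; d] r) (row i E)) =
    W *m g x *m E^T.
  apply/matrixP => r i; rewrite mxE inner_row.
  have -> : nth 0 [:: a; b; c; d] r = row r W by apply/rowP => k; rewrite !mxE.
  by rewrite -!row_mul mxE.
by rewrite !det_mulmx det_tr; ring.
Qed.

Lemma det22 (B : 'M[R]_2) :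
  \det B = B 0 0 * B 1 1 - B 0 1 * B 1 0.
Proof.
have e1 : lift ord0 ord0 = 1 :> 'I_2 by apply: val_inj.
have e0 : lift 1 ord0 = 0 :> 'I_2 by apply: val_inj.
rewrite (expand_det_row _ 0) !big_ord_recl big_ord0 /cofactor !det_mx11 !mxE /=.
by rewrite !e1 e0; ring.
Qed.

Lemma wedge2E E i j X Y :
  wedge2 E i j X Y = coframe E i X * coframe E j Y - coframe E i Y * coframe E j X.
Proof. by rewrite /wedge2 det22 !mxE. Qed.

Lemma wedge3E E i j k X Y Z :
  wedge3 E i j k X Y Z =
    coframe E i X * (coframe E j Y * coframe E k Z - coframe E j Z * coframe E k Y)
  - coframe E i Y * (coframe E j X * coframe E k Z - coframe E j Z * coframe E k X)
  + coframe E i Z * (coframe E j X * coframe E k Y - coframe E j Y * coframe E k X).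
Proof.
rewrite /wedge3 (expand_det_row _ ord0) !big_ord_recl big_ord0 /cofactor.
by rewrite !det22 !mxE /=; ring.
Qed.

Lemma det_mx44_unit_row (B : 'M[R]_4) :
  row 0 B = delta_mx 0 0 ->
  let b i j := B (inord i) (inord j) in
  \det B = b 1 1 * (b 2 2 * b 3 3 - b 2 3 * b 3 2)
         - b 1 2 * (b 2 1 * b 3 3 - b 2 3 * b 3 1)
         + b 1 3 * (b 2 1 * b 3 2 - b 2 2 * b 3 1).
Proof.
move=> B0 b.
have B0E j : B 0 j = (j == 0)%:R.
  by move/rowP: B0 => /(_ j); rewrite !mxE.
have bE i j : B i j = b i j by rewrite /b !inord_val.
rewrite (expand_det_row _ 0) big_ord_recl big1 => [|j _]; last first.
  by rewrite B0E mul0r.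
rewrite B0E eqxx mul1r addr0 /cofactor (expand_det_row _ ord0).
rewrite !big_ord_recl big_ord0 /cofactor !det22 !mxE !bE /=; ring.
Qed.

Section AdaptedFrames.
Variable E : 'M[R]_4.
Hypothesis gsym : (g x)^T = g x.
Hypothesis detg : 0 < \det (g x).
Hypothesis frameE : adapted_frame E.

Let vol4_coord a b c :
  vol4 (g x) u a b c =
  let k v i := inner (g x) v (row (inord i) E) in
    k a 1 * (k b 2 * k c 3 - k b 3 * k c 2)
  - k a 2 * (k b 1 * k c 3 - k b 3 * k c 1)
  + k a 3 * (k b 1 * k c 2 - k b 2 * k c 1).
Proof.
have [E0 EgE detE] := frameE.
rewrite (vol4_frame _ _ _ _ EgE)// det_mx44_unit_row.
  by rewrite !mxE !inordK.
by apply/rowP => j; rewrite !mxE /= inner_row -E0 -!row_mul EgE !mxE eq_sym.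
Qed.

Let inner_coord v w :
  inner (g x) v w =
  let k v i := inner (g x) v (row (inord i) E) in
  k v 0 * k w 0 + k v 1 * k w 1 + k v 2 * k w 2 + k v 3 * k w 3.
Proof.
have [_ EgE _] := frameE.
rewrite (inner_sum_frame _ _ gsym EgE) /=.
pose k v i := inner (g x) v (row (inord i : 'I_4) E).
transitivity (\sum_(i < 4) k v i * k w i).
  by apply: eq_bigr => i _; rewrite /k inord_val.
by rewrite !big_ord_recl big_ord0 /= addr0 !addrA.
Qed.

Let coord0 v : inner (g x) v (row (inord 0) E) = inner (g x) u v.
Proof.
have [<- _ _] := frameE.
have -> : inord 0 = 0 :> 'I_4 by apply: val_inj; rewrite /= inordK.
rewrite /inner -[in LHS](trmxK (_ *m _)) mxE !trmx_mul !trmxK gsym.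
by rewrite mulmxA.
Qed.

Lemma muE X : mu X = coframe E 0 X.
Proof. by rewrite /coframe/= coord0. Qed.

Lemma betaE X Y : sphere_tangent X -> sphere_tangent Y ->
  beta X Y = wedge2 E 1 4 X Y + wedge2 E 2 5 X Y + wedge2 E 3 6 X Y.
Proof.
rewrite /sphere_tangent -!coord0 => X0 Y0.
rewrite /beta !inner_coord /= X0 Y0 !wedge2E /coframe/=; ring.
Qed.

Lemma alphaE X Y Z : alpha X Y Z = wedge3 E 4 5 6 X Y Z.
Proof. by rewrite /alpha vol4_coord wedge3E /coframe/=; ring. Qed.

Lemma alpha2E X Y Z :
  alpha2 X Y Z = wedge3 E 1 2 6 X Y Z + wedge3 E 2 3 4 X Y Z + wedge3 E 3 1 5 X Y Z.
Proof. by rewrite /alpha2 !vol4_coord !wedge3E /coframe/=; ring. Qed.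

Lemma phiE X Y Z :
  sphere_tangent X -> sphere_tangent Y -> sphere_tangent Z ->
  phi X Y Z =
    wedge3 E 4 5 6 X Y Z
    + (wedge3 E 0 1 4 X Y Z + wedge3 E 0 2 5 X Y Z + wedge3 E 0 3 6 X Y Z)
    - (wedge3 E 1 2 6 X Y Z + wedge3 E 2 3 4 X Y Z + wedge3 E 3 1 5 X Y Z).
Proof.
move=> X0 Y0 Z0; rewrite /phi alphaE -alpha2E /mu_wedge_beta !muE !betaE//.
by rewrite !wedge2E !wedge3E; ring.
Qed.

End AdaptedFrames.

End SphereBundleAlgebra.

Section SphereBundle.
Variables (R : realType) (M : topologicalType) (A : oriented_atlas R 4 M).
Variable g : riemannian_metric A.

(* The local parametrizations of the 7-manifold S_M, seen as a submanifold of
   TM: injective immersions of an open set of R^7 into TM with values in the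
   unit vectors, written in the bundle coordinates (x, v) of TM given by a
   chart of M. *)
Record sphere_param := SphereParam {
  sp_index : atlas_index A;
  sp_dom : set 'rV[R]_7;
  sp_point : 'rV[R]_7 -> 'rV[R]_4;
  sp_vect : 'rV[R]_7 -> 'rV[R]_4;
  sp_open : open sp_dom;
  sp_point_smooth : smooth_on sp_dom sp_point;
  sp_vect_smooth : smooth_on sp_dom sp_vect;
  sp_chart : forall t, sp_dom t -> chart_img (atlas_chart sp_index) (sp_point t);
  sp_unit : forall t, sp_dom t ->
    inner (metric_mx g sp_index (sp_point t)) (sp_vect t) (sp_vect t) = 1;
  sp_inj : forall s t, sp_dom s -> sp_dom t ->
    sp_point s = sp_point t -> sp_vect s = sp_vect t -> s = t;
  sp_immersion : forall t, sp_dom t ->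
    row_free (row_mx ('J sp_point t) ('J sp_vect t))
}.

Definition sp_field (P : sphere_param) (t : 'rV[R]_7) (a : 'I_7) :
    'rV[R]_4 * 'rV[R]_4 :=
  (partial a (sp_point P) t, partial a (sp_vect P) t).

Definition sp_metric (P : sphere_param) (t : 'rV[R]_7) : 'M[R]_7 :=
  \matrix_(a, b) sphere_metric (metric_mx g (sp_index P)) (sp_point P t)
                   (sp_vect P t) (sp_field P t a) (sp_field P t b).

Definition sp_phi (P : sphere_param) (t : 'rV[R]_7) (a b c : 'I_7) : R :=
  phi (metric_mx g (sp_index P)) (sp_point P t) (sp_vect P t)
    (sp_field P t a) (sp_field P t b) (sp_field P t c).

(* phi is parallel for the Levi-Civita connection of S_M. *)
Definition sphere_bundle_is_G2_manifold : Prop :=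
  forall P : sphere_param, parallel_on (sp_dom P) (sp_metric P) (sp_phi P).

End SphereBundle.

(* Main.v *)
(* A form which is parallel for a torsion-free connection is closed, and phi is
   never closed.  Fix a unit vector u = e_0, an orthonormal frame e_0, ..., e_3 and
   a cyclic permutation (i, j, k) of (1, 2, 3), and evaluate dphi on the horizontal
   lifts of e_j, e_k and the vertical lifts of e_j, e_k.  The form alpha contributes
   Vol(e_0, R(e_j, e_k) u, e_j, e_k) = <R(e_j, e_k) u, e_i> Vol(e_0, e_1, e_2, e_3),
   the form mu /\ beta contributes 2 because dmu = - beta, and alpha_2 contributes
   nothing.  By the first Bianchi identity the curvature terms cancel in the sum
   over the three cyclic permutations, which is therefore 6. *)

Require Import Defs.
From mathcomp Require Import all_boot all_order all_algebra.
From mathcomp Require Import all_classical all_reals all_analysis.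
From mathcomp Require Import ring lra.

Set Implicit Arguments.
Unset Strict Implicit.
Unset Printing Implicit Defensive.
Import Order.TTheory GRing.Theory Num.Theory.
Import numFieldNormedType.Exports.
Local Open Scope classical_set_scope.
Local Open Scope ring_scope.

(** * Smooth functions *)

Section Differentiability.
Variables (R : realType) (V W : normedModType R).

(** Parallelism is tested in parametrizations of S_M, so the lifts of the frame have to be values of
    the coordinate fields of one explicit parametrization, at its origin. The vertical parts [V] of
    the horizontal coordinate fields vanish there. Hence [vol4] is differentiated at a zero of one
    argument, and neither the derivative of the volume form nor those of its other arguments enter.
    No curvature tensor is introduced: <R(e_j, e_k) u, e_i> is the antisymmetrization in j and k of
    the i-th component of the derivative of [V (hor k)] along the j-th horizontal direction. The
    cyclic sum can be regrouped so that the antisymmetrization bears on i and k, where the symmetry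
    of the Christoffel symbols applies. On one horizontal and two vertical vectors alpha_2 is zero
    by type. In the two vertical derivatives it vanishes because, when u moves along the j-th
    vertical line, it stays in the plane of e_0 and e_j, and the k-th vertical field in the span of
    u and e_k. *)

Lemma near_eq_differentiable (f g : V -> W) x :
  {near x, f =1 g} -> differentiable f x -> differentiable g x.
Proof.
move=> fg /diff_locallyP [dfc dxf].
have dxg : g \o shift x = cst (g x) + 'd f x +o_ 0 id.
  move/eqaddoP: dxf => dxf; apply/eqaddoP => e e0.
  have fg0 : \forall y \near (0 : V), f (y + x) = g (y + x).
    by have := near_shift 0 x (fun z => f z = g z); rewrite /= subr0 => <-.
  apply: filterS2 fg0 (dxf e e0) => y E.
  by rewrite !fctE/= E (nbhs_singleton fg).
apply/diff_locallyP; rewrite (diff_unique dfc dxg).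
by split.
Qed.

End Differentiability.

Section Smoothness.
Variables (R : realType) (n : nat).
Implicit Types W : set 'rV[R]_n.

Section NormedModule.
Variable V : normedModType R.
Implicit Type f : 'rV[R]_n -> V.

(** The Leibniz rule expresses a derivative of a product through the factors and their derivatives,
    so closure properties are proved by induction on the order; hence this truncation. *)
Definition smooth_upto k W f : Prop := forall s x,
  (size s <= k)%N -> W x -> differentiable (iter_partial s f) x.

Lemma smooth_uptoP W f : smooth_on W f <-> forall k, smooth_upto k W f.
Proof.
split=> [fW k s x _|fW s x]; first exact: fW.
exact: fW (leqnn (size s)).
Qed.

Lemma smooth_upto_differentiable k W f x :
  smooth_upto k W f -> W x -> differentiable f x.
Proof. by move=> fW; apply: (fW [::]). Qed.

Lemma smooth_upto_partial k W f a :
  smooth_upto k.+1 W f -> smooth_upto k W (partial a f).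
Proof.
move=> fW s x sk Wx.
(* [foldr] differentiates first along the last index of the list. *)
have := fW (rcons s a) x; rewrite size_rcons ltnS => /(_ sk Wx).
by rewrite /iter_partial foldr_rcons.
Qed.

Lemma smooth_upto0 W f :
  (forall x, W x -> differentiable f x) -> smooth_upto 0 W f.
Proof. by move=> fW [|//] x _; apply: fW. Qed.

Lemma smooth_uptoS k W f : (forall x, W x -> differentiable f x) ->
  (forall a, smooth_upto k W (partial a f)) -> smooth_upto k.+1 W f.
Proof.
move=> fW dfW s x; case/lastP: s => [_|s a]; first exact: fW.
rewrite size_rcons ltnS /iter_partial foldr_rcons; exact: dfW.
Qed.

Lemma smooth_uptoW k W f : smooth_upto k.+1 W f -> smooth_upto k W f.
Proof. by move=> fW s x sk; apply: fW; apply: leq_trans sk _. Qed.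

Lemma eq_smooth_upto k W f f' : open W ->
  (forall x, W x -> f x = f' x) -> smooth_upto k W f -> smooth_upto k W f'.
Proof.
move=> oW.
have near_eq h h' x : W x -> (forall x, W x -> h x = h' x) ->
    {near x, h =1 h' :> ('rV[R]_n -> V)}.
  by move=> Wx hh'; apply: filterS (open_nbhs_nbhs (conj oW Wx)).
elim: k f f' => [|k IH] f f' ff' fW.
  apply: smooth_upto0 => x Wx.
  apply: near_eq_differentiable (near_eq _ _ _ Wx ff') _.
  exact: smooth_upto_differentiable fW Wx.
apply: smooth_uptoS => [x Wx|a].
  apply: near_eq_differentiable (near_eq _ _ _ Wx ff') _.
  exact: smooth_upto_differentiable fW Wx.
apply: (IH _ _ _ (smooth_upto_partial a fW)) => x Wx.
exact: near_eq_derive (near_eq _ _ _ Wx ff').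
Qed.

Lemma smooth_on_differentiable W f x :
  smooth_on W f -> W x -> differentiable f x.
Proof. by move=> fW; apply: (fW [::]). Qed.

Lemma smooth_on_derivable W f x v :
  smooth_on W f -> W x -> derivable f x v.
Proof. by move=> fW Wx; apply/diff_derivable/(smooth_on_differentiable fW). Qed.

Lemma smooth_on_partial W f a : smooth_on W f -> smooth_on W (partial a f).
Proof.
by move/smooth_uptoP=> fW; apply/smooth_uptoP => k; apply: smooth_upto_partial.
Qed.

Lemma eq_smooth_on W f f' : open W -> (forall x, W x -> f x = f' x) ->
  smooth_on W f -> smooth_on W f'.
Proof.
move=> oW ff' /smooth_uptoP fW; apply/smooth_uptoP => k.
exact: eq_smooth_upto (fW k).
Qed.

Lemma smooth_upto_cst k W (c : V) : smooth_upto k W (fun=> c).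
Proof.
elim: k c => [|k IH] c.
  by apply: smooth_upto0 => x _; apply: differentiable_cst.
apply: smooth_uptoS => [x _|a]; first exact: differentiable_cst.
rewrite (_ : partial a _ = fun=> 0); first exact: IH.
by apply/funext => x; rewrite /partial derive_cst.
Qed.

Lemma smooth_on_cst W (c : V) : smooth_on W (fun=> c).
Proof. by apply/smooth_uptoP => k; exact: smooth_upto_cst. Qed.

Lemma smooth_uptoD k W f f' : open W -> smooth_upto k W f ->
  smooth_upto k W f' -> smooth_upto k W (fun x => f x + f' x).
Proof.
move=> oW; elim: k f f' => [|k IH] f f' fW fW'; last apply: smooth_uptoS.
- apply: smooth_upto0 => x Wx.
  by apply: differentiableD; [exact: fW [::] x _ Wx|exact: fW' [::] x _ Wx].
- move=> x Wx.
  by apply: differentiableD; [exact: fW [::] x _ Wx|exact: fW' [::] x _ Wx].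
move=> a; have := IH _ _ (smooth_upto_partial a fW) (smooth_upto_partial a fW').
apply: eq_smooth_upto => // x Wx; rewrite /partial deriveD//.
  exact/diff_derivable/(fW [::]).
exact/diff_derivable/(fW' [::]).
Qed.

Lemma smooth_onD W f f' : open W ->
  smooth_on W f -> smooth_on W f' -> smooth_on W (fun x => f x + f' x).
Proof.
move=> oW /smooth_uptoP fW /smooth_uptoP fW'; apply/smooth_uptoP => k.
exact: smooth_uptoD.
Qed.

Lemma smooth_on_sum W (I : Type) (r : seq I) (P : pred I)
    (F : I -> 'rV[R]_n -> V) : open W -> (forall i, P i -> smooth_on W (F i)) ->
  smooth_on W (fun x => \sum_(i <- r | P i) F i x).
Proof.
move=> oW FW; elim: r => [|i r IH].
  apply: (eq_smooth_on oW _ (smooth_on_cst (0 : V))) => x _.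
  by rewrite big_nil.
have [Pi|NPi] := boolP (P i); last first.
  by apply: (eq_smooth_on oW _ IH) => x _; rewrite big_cons (negPf NPi).
apply: (eq_smooth_on oW _ (smooth_onD oW (FW i Pi) IH)) => x _.
by rewrite big_cons Pi.
Qed.

End NormedModule.

Section Scalar.
Implicit Types f q : 'rV[R]_n -> R.

Lemma smooth_uptoM k W f f' : open W -> smooth_upto k W f ->
  smooth_upto k W f' -> smooth_upto k W (fun x => f x * f' x).
Proof.
move=> oW; elim: k f f' => [|k IH] f f' fW fW'; last apply: smooth_uptoS.
- apply: smooth_upto0 => x Wx.
  by apply: differentiableM; [exact: fW [::] x _ Wx|exact: fW' [::] x _ Wx].
- move=> x Wx.
  by apply: differentiableM; [exact: fW [::] x _ Wx|exact: fW' [::] x _ Wx].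
move=> a; have := smooth_uptoD oW
  (IH _ _ (smooth_uptoW fW) (smooth_upto_partial a fW'))
  (IH _ _ (smooth_uptoW fW') (smooth_upto_partial a fW)).
apply: eq_smooth_upto => // x Wx; rewrite /partial deriveM//.
  exact/diff_derivable/(fW [::]).
exact/diff_derivable/(fW' [::]).
Qed.

Lemma smooth_onM W f f' : open W ->
  smooth_on W f -> smooth_on W f' -> smooth_on W (fun x => f x * f' x).
Proof.
move=> oW /smooth_uptoP fW /smooth_uptoP fW'; apply/smooth_uptoP => k.
exact: smooth_uptoM.
Qed.

Lemma smooth_on_prod W (I : Type) (r : seq I) (P : pred I)
    (F : I -> 'rV[R]_n -> R) : open W -> (forall i, P i -> smooth_on W (F i)) ->
  smooth_on W (fun x => \prod_(i <- r | P i) F i x).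
Proof.
move=> oW FW; elim: r => [|i r IH].
  apply: (eq_smooth_on oW _ (smooth_on_cst (1 : R))) => x _.
  by rewrite big_nil.
have [Pi|NPi] := boolP (P i); last first.
  by apply: (eq_smooth_on oW _ IH) => x _; rewrite big_cons (negPf NPi).
apply: (eq_smooth_on oW _ (smooth_onM oW (FW i Pi) IH)) => x _.
by rewrite big_cons Pi.
Qed.

Lemma smooth_onZl W (c : R) f : open W ->
  smooth_on W f -> smooth_on W (fun x => c * f x).
Proof. by move=> oW; apply: smooth_onM => //; exact: smooth_on_cst. Qed.

(* The equation bootstraps the regularity of f.  Powers f = q ^ r satisfy it with
   c = r and m = 1 - 1 / r. *)
Lemma smooth_on_power W f q (c : R) m : open W -> smooth_on W q ->
  (forall x, W x -> differentiable f x) ->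
  (forall x a, W x -> partial a f x = c * f x ^+ m * partial a q x) ->
  smooth_on W f.
Proof.
move=> oW /smooth_uptoP qW df dfE; apply/smooth_uptoP; elim=> [|k IH].
  exact: smooth_upto0.
apply: smooth_uptoS => // a.
have fX : smooth_upto k W (fun x => f x ^+ m).
  elim: m {dfE} => [|m IHm].
    apply: (eq_smooth_upto oW _ (smooth_upto_cst (1 : R))) => x _.
    by rewrite expr0.
  apply: (eq_smooth_upto oW _ (smooth_uptoM oW IH IHm)) => x _.
  by rewrite exprS.
have := smooth_uptoM oW (smooth_uptoM oW (smooth_upto_cst c) fX)
  (smooth_upto_partial a (qW k.+1)).
by apply: eq_smooth_upto => // x Wx; rewrite dfE.
Qed.

Lemma smooth_onV W q : open W -> (forall x, W x -> q x != 0) ->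
  smooth_on W q -> smooth_on W (fun x => (q x)^-1).
Proof.
move=> oW q0 qW; apply: (smooth_on_power (c := -1) (m := 2) oW qW) => [x Wx|x a Wx].
  by apply: differentiableV; [exact: smooth_on_differentiable qW Wx|exact: q0].
rewrite /partial deriveV ?q0//; last exact: smooth_on_derivable qW Wx.
by rewrite exprVn mulN1r.
Qed.

Lemma smooth_on_sqrtV W q : open W -> (forall x, W x -> 0 < q x) ->
  smooth_on W q -> smooth_on W (fun x => (Num.sqrt (q x))^-1).
Proof.
move=> oW q0 qW.
have sq0 x : W x -> Num.sqrt (q x) != 0.
  by move=> Wx; rewrite gt_eqF// sqrtr_gt0 q0.
have sd x : W x -> differentiable (fun x => Num.sqrt (q x)) x.
  move=> Wx; apply: differentiable_comp (smooth_on_differentiable qW Wx) _.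
  apply/derivable1_diffP; have [] := is_derive1_sqrt (q0 x Wx); exact.
apply: (smooth_on_power (c := - 2^-1) (m := 3) oW qW) => [x Wx|x a Wx].
  by apply: differentiableV; [exact: sd|exact: sq0].
rewrite /partial deriveV ?sq0//; last exact/diff_derivable/sd.
(* The derivative of the square root is extracted from that of its square, which is q near x. *)
have sqE : 'D_(delta_mx 0 a) (fun x => Num.sqrt (q x) * Num.sqrt (q x)) x =
    'D_(delta_mx 0 a) q x.
  apply: near_eq_derive; apply: filterS (open_nbhs_nbhs (conj oW Wx)) => y Wy.
  by rewrite -expr2 sqr_sqrtr// ltW// q0.
rewrite -sqE deriveM; [|exact/diff_derivable/sd..].
set d := 'D__ _ x; rewrite /GRing.scale/=.
by field; rewrite sq0.
Qed.

(** The power 1/2 would need the exponent m = -1 in [smooth_on_power], so sqrt(q) is written as q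
    times q^(-1/2). *)
Lemma smooth_on_sqrt W q : open W -> (forall x, W x -> 0 < q x) ->
  smooth_on W q -> smooth_on W (fun x => Num.sqrt (q x)).
Proof.
move=> oW q0 qW.
apply: (eq_smooth_on oW _ (smooth_onM oW qW (smooth_on_sqrtV oW q0 qW))) => x Wx.
rewrite -[X in X / _]sqr_sqrtr; last by rewrite ltW// q0.
by rewrite expr2 mulfK// gt_eqF// sqrtr_gt0 q0.
Qed.

End Scalar.
End Smoothness.

(** * Matrix-valued functions and affine maps *)

Section MatrixDifferentiability.
Variables (R : realType) (V : normedModType R).

Lemma differentiable_mx m n (f : V -> 'M[R]_(m, n)) x :
  (forall i j, differentiable (fun y => f y i j) x) -> differentiable f x.
Proof.
move=> df.
have -> : f = \sum_i \sum_j (fun y => f y i j *: delta_mx i j).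
  apply/funext => y; rewrite fct_sumE [LHS]matrix_sum_delta.
  by apply: eq_bigr => i _; rewrite fct_sumE.
apply: differentiable_sum => i; apply: differentiable_sum => j.
exact: differentiableZl.
Qed.

Lemma differentiable_mx_coord m n (f : V -> 'M[R]_(m, n)) x i j :
  differentiable f x -> differentiable (fun y => f y i j) x.
Proof. by move=> df; apply: differentiable_comp df (differentiable_coord _ _ _). Qed.

Lemma derive_mx_coord m n (f : V -> 'M[R]_(m, n)) x v i j :
  derivable f x v -> 'D_v (fun y => f y i j) x = ('D_v f x) i j.
Proof. by move=> /derive_mx ->; rewrite mxE. Qed.

End MatrixDifferentiability.

Section Affine.
Variables (R : realType) (m n : nat) (x0 : 'rV[R]_m) (X : 'M[R]_(n, m)).

Definition affine (t : 'rV[R]_n) : 'rV[R]_m := x0 + t *m X.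

(** Both sides are limits of the same difference quotient, since the map sends the line through [t]
    along [v] to the line through [affine t] along [v *m X]. *)
Lemma derive_affine_comp (V : normedModType R) (f : 'rV[R]_m -> V) t v :
  'D_v (fun t => f (affine t)) t = 'D_(v *m X) f (affine t).
Proof.
rewrite /derive /affine; set d := (fun _ : R => _); set d' := (fun _ : R => _).
suff -> : d = d' by [].
apply/funext => h; rewrite /d /d' /=.
by rewrite mulmxDl -scalemxAl addrCA.
Qed.

Lemma differentiable_affine t : differentiable affine t.
Proof.
apply: differentiable_mx => i j.
rewrite (_ : (fun s => _) =
  cst (x0 i j) + \sum_k (fun s : 'rV[R]_n => X k j *: (s i k : R))).
  apply: differentiableD; first exact: differentiable_cst.
  by apply: differentiable_sum => k; apply: differentiableZ;
    exact: differentiable_coord.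
apply/funext => s; rewrite !mxE/=; congr (_ + _); rewrite fct_sumE.
by apply: eq_bigr => k _; rewrite mulrC.
Qed.

Lemma continuous_affine : continuous affine.
Proof. by move=> t; apply/differentiable_continuous/differentiable_affine. Qed.

Lemma derive_affine t v : 'D_v affine t = v *m X.
Proof.
have := derive_affine_comp id t v; rewrite derive_id => <-.
by congr derive.
Qed.

End Affine.

Lemma derive_partial (R : realType) n (V : normedModType R)
    (f : 'rV[R]_n -> V) x v :
  differentiable f x -> 'D_v f x = \sum_a v 0 a *: partial a f x.
Proof.
move=> df; rewrite deriveE// {1}(row_sum_delta v) linear_sum.
by apply: eq_bigr => a _; rewrite linearZ/= /partial deriveE.
Qed.

Section MatrixSmoothness.
Variables (R : realType) (n : nat).
Implicit Types W : set 'rV[R]_n.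

Lemma smooth_on_coord W m p (f : 'rV[R]_n -> 'M[R]_(m, p)) i j :
  open W -> smooth_on W f -> smooth_on W (fun x => f x i j : R).
Proof.
move=> oW /smooth_uptoP fW; apply/smooth_uptoP => k.
have {fW} := fW k; elim: k f => [|k IH] f fW; last apply: smooth_uptoS.
- apply: smooth_upto0 => x Wx.
  exact/differentiable_mx_coord/(fW [::]).
- move=> x Wx; exact/differentiable_mx_coord/(fW [::]).
move=> a; have := IH _ (smooth_upto_partial a fW).
apply: eq_smooth_upto => // x Wx; rewrite /partial derive_mx_coord//.
exact/diff_derivable/(fW [::]).
Qed.

Lemma smooth_on_mx W m p (f : 'rV[R]_n -> 'M[R]_(m, p)) : open W ->
  (forall i j, smooth_on W (fun x => f x i j : R)) -> smooth_on W f.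
Proof.
move=> oW fW; apply/smooth_uptoP => k.
have {fW} : forall i j, smooth_upto k W (fun x => f x i j : R).
  by move=> i j; have /smooth_uptoP := fW i j; exact.
elim: k f => [|k IH] f fW; last apply: smooth_uptoS.
- apply: smooth_upto0 => x Wx; apply: differentiable_mx => i j.
  exact: fW [::] x _ Wx.
- move=> x Wx; apply: differentiable_mx => i j; exact: fW [::] x _ Wx.
move=> a; apply: IH => i j; have := smooth_upto_partial a (fW i j).
apply: eq_smooth_upto => // x Wx; rewrite /partial derive_mx_coord//.
apply/diff_derivable/differentiable_mx => ? ?; exact: fW [::] x _ Wx.
Qed.

Lemma smooth_on_det W m (f : 'rV[R]_n -> 'M[R]_m) : open W ->
  (forall i j, smooth_on W (fun x => f x i j : R)) ->
  smooth_on W (fun x => \det (f x)).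
Proof.
move=> oW fW; apply: smooth_on_sum => // s _; apply: smooth_onZl => //.
exact: smooth_on_prod.
Qed.

Lemma smooth_on_invmx W m (f : 'rV[R]_n -> 'M[R]_m) i j : open W ->
  (forall x, W x -> f x \in unitmx) ->
  (forall i j, smooth_on W (fun x => f x i j : R)) ->
  smooth_on W (fun x => invmx (f x) i j : R).
Proof.
move=> oW fu fW.
have aW : smooth_on W (fun x => (\adj (f x)) i j : R).
  have : smooth_on W (fun x => (-1) ^+ (j + i) * \det (row' j (col' i (f x)))).
    apply: smooth_onZl => //; apply: smooth_on_det => // k l.
    apply: (eq_smooth_on oW _ (fW (lift j k) (lift i l))) => x _.
    by rewrite !mxE.
  by apply: eq_smooth_on => // x _; rewrite !mxE.
have dW : smooth_on W (fun x => (\det (f x))^-1).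
  apply: smooth_onV => //; last exact: smooth_on_det.
  by move=> x Wx; have := fu x Wx; rewrite unitmxE unitfE.
apply: (eq_smooth_on oW _ (smooth_onM oW dW aW)) => x Wx.
by rewrite /invmx fu// !mxE.
Qed.

Lemma smooth_on_affine_comp W m (f : 'rV[R]_n -> R) x0 (X : 'M[R]_(m, n)) :
  open W -> smooth_on W f ->
  smooth_on (affine x0 X @^-1` W) (fun t => f (affine x0 X t)).
Proof.
move=> oW /smooth_uptoP fW; apply/smooth_uptoP => k.
have oA : open (affine x0 X @^-1` W).
  by apply: open_comp => // t _; exact: continuous_affine.
have {fW} := fW k; elim: k f => [|k IH] f fW; last apply: smooth_uptoS.
- apply: smooth_upto0 => t Wt; apply: differentiable_comp (differentiable_affine _ _ _) _.
  exact: fW [::] _ _ Wt.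
- move=> t Wt; apply: differentiable_comp (differentiable_affine _ _ _) _.
  exact: fW [::] _ _ Wt.
move=> a.
have : smooth_upto k (affine x0 X @^-1` W)
    (fun t => \sum_b X a b * partial b f (affine x0 X t)).
  elim: (index_enum _) => [|b s IHs].
    apply: (eq_smooth_upto oA _ (smooth_upto_cst (0 : R))) => t _.
    by rewrite big_nil.
  apply: (eq_smooth_upto oA _ (smooth_uptoD oA (smooth_uptoM oA
    (smooth_upto_cst (X a b)) (IH _ (smooth_upto_partial b fW))) IHs)) => t _.
  by rewrite big_cons.
apply: eq_smooth_upto => // t Wt; rewrite {2}/partial derive_affine_comp.
rewrite derive_partial; last exact: fW [::] _ _ Wt.
by apply: eq_bigr => b _; rewrite -rowE !mxE.
Qed.

End MatrixSmoothness.

Section MatrixProducts.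
Variables (R : realType) (n : nat) (W : set 'rV[R]_n).
Hypothesis oW : open W.

Lemma smooth_on_mulmx m p q (A : 'rV[R]_n -> 'M[R]_(m, p))
    (B : 'rV[R]_n -> 'M[R]_(p, q)) :
  smooth_on W A -> smooth_on W B -> smooth_on W (fun x => A x *m B x).
Proof.
move=> AW BW; apply: smooth_on_mx => // i j.
have : smooth_on W (fun x => \sum_k A x i k * B x k j).
  by apply: smooth_on_sum => // k _; apply: smooth_onM => //; exact: smooth_on_coord.
by apply: eq_smooth_on => // x _; rewrite mxE.
Qed.

Lemma smooth_on_trmx m p (A : 'rV[R]_n -> 'M[R]_(m, p)) :
  smooth_on W A -> smooth_on W (fun x => (A x)^T).
Proof.
move=> AW; apply: smooth_on_mx => // i j.
apply: (eq_smooth_on oW _ (smooth_on_coord j i oW AW)) => x _.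
by rewrite mxE.
Qed.

Lemma smooth_on_scalemx m p (c : 'rV[R]_n -> R) (A : 'rV[R]_n -> 'M[R]_(m, p)) :
  smooth_on W c -> smooth_on W A -> smooth_on W (fun x => c x *: A x).
Proof.
move=> cW AW; apply: smooth_on_mx => // i j.
apply: (eq_smooth_on oW _ (smooth_onM oW cW (smooth_on_coord i j oW AW))) => x _.
by rewrite mxE.
Qed.

Lemma smooth_on_affine m x0 (X : 'M[R]_(n, m)) : smooth_on W (affine x0 X).
Proof.
apply/smooth_uptoP => - [|k].
  by apply: smooth_upto0 => x _; exact: differentiable_affine.
apply: smooth_uptoS => [x _|a]; first exact: differentiable_affine.
rewrite (_ : partial a _ = fun=> delta_mx 0 a *m X).
  exact: smooth_upto_cst.
by apply/funext => x; rewrite /partial derive_affine.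
Qed.

End MatrixProducts.

Section MatrixDerivative.
Variables (R : realType) (V : normedModType R) (t v : V).

Lemma derivable_mulmx m n p (A : V -> 'M[R]_(m, n)) (B : V -> 'M[R]_(n, p)) :
  derivable A t v -> derivable B t v -> derivable (fun s => A s *m B s) t v.
Proof.
move=> /derivable_mxP dA /derivable_mxP dB; apply/derivable_mxP => i j.
rewrite (_ : (fun s => _) = \sum_k (fun s => A s i k * B s k j)).
  by apply: derivable_sum => k; exact: derivableM.
by apply/funext => s; rewrite mxE fct_sumE.
Qed.

Lemma derive_mulmx m n p (A : V -> 'M[R]_(m, n)) (B : V -> 'M[R]_(n, p)) :
  derivable A t v -> derivable B t v ->
  'D_v (fun s => A s *m B s) t = 'D_v A t *m B t + A t *m 'D_v B t.
Proof.
move=> dA dB; rewrite derive_mx; last exact: derivable_mulmx.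
apply/matrixP => i j; rewrite !mxE -big_split /=.
rewrite (_ : (fun s => _) = \sum_k (fun s => A s i k * B s k j)); last first.
  by apply/funext => s; rewrite mxE fct_sumE.
have [/derivable_mxP dA' /derivable_mxP dB'] := (dA, dB).
rewrite derive_sum; last by move=> k; exact: derivableM.
apply: eq_bigr => k _; rewrite deriveM// !derive_mx_coord//.
by rewrite addrC /GRing.scale /=; congr (_ + _); rewrite mulrC.
Qed.

Lemma derivable_trmx m n (A : V -> 'M[R]_(m, n)) :
  derivable A t v -> derivable (fun s => (A s)^T) t v.
Proof.
move=> /derivable_mxP dA; apply/derivable_mxP => i j.
by rewrite (_ : (fun s => _) = fun s => A s j i)//; apply/funext => s; rewrite mxE.
Qed.

Lemma derive_trmx m n (A : V -> 'M[R]_(m, n)) :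
  derivable A t v -> 'D_v (fun s => (A s)^T) t = ('D_v A t)^T.
Proof.
move=> dA; rewrite derive_mx; last exact: derivable_trmx.
apply/matrixP => i j; rewrite [LHS]mxE [RHS]mxE -derive_mx_coord//.
by under eq_fun do rewrite mxE.
Qed.

(** Meant for the alpha_2 term, whose vanishing is known only on a vertical line. *)
Lemma eq_derive_line (W : normedModType R) (f f' : V -> W) :
  (forall h, f (h *: v + t) = f' (h *: v + t)) -> 'D_v f t = 'D_v f' t.
Proof.
move=> ff'; have ft : f t = f' t by have := ff' 0; rewrite scale0r add0r.
rewrite /derive ft; set d := (fun _ : R => _); set d' := (fun _ : R => _).
suff -> : d = d' by [].
by apply/funext => h; rewrite /d /d' /= ff'.
Qed.

Lemma deriveM_root (f f' : V -> R) : derivable f t v -> derivable f' t v ->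
  f t = 0 -> 'D_v (fun s => f s * f' s) t = 'D_v f t * f' t.
Proof.
by move=> df df' f0; rewrite deriveM// f0 scale0r add0r /GRing.scale/= mulrC.
Qed.

End MatrixDerivative.

(** Shaped after [param_phi_hhv]: [b] and [b'] stand for <u, f j> and <u, f k>, which vanish at the
    origin because u = e_0 there. *)
Lemma derive_sub_roots (R : realType) (V : normedModType R) (t v : V)
    (a b c b' c' d : V -> R) :
  derivable a t v -> derivable b t v -> derivable c t v ->
  derivable b' t v -> derivable c' t v -> derivable d t v ->
  b t = 0 -> b' t = 0 ->
  'D_v (fun y => a y + (b y * c y - b' y * c' y) - d y) t =
  'D_v a t + ('D_v b t * c t - 'D_v b' t * c' t) - 'D_v d t.
Proof.
move=> da db dc db' dc' dd b0 b'0.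
have dbc := derivableM db dc; have dbc' := derivableM db' dc'.
apply: etrans (deriveB (derivableD da (derivableB dbc dbc')) dd) _.
congr (_ - _); apply: etrans (deriveD da (derivableB dbc dbc')) _.
congr (_ + _); apply: etrans (deriveB dbc dbc') _.
by congr (_ - _); exact: deriveM_root.
Qed.

(** * Inner product, volume form and phi *)

Section Inner.
Variables (R : realType) (n : nat) (g : 'M[R]_n).
Implicit Types v w : 'rV[R]_n.

Lemma innerDl v v' w : inner g (v + v') w = inner g v w + inner g v' w.
Proof. by rewrite /inner !mulmxDl mxE. Qed.

Lemma innerZl c v w : inner g (c *: v) w = c * inner g v w.
Proof. by rewrite /inner -!scalemxAl mxE. Qed.

Lemma inner0l w : inner g 0 w = 0.
Proof. by rewrite /inner !mul0mx mxE. Qed.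

Lemma inner0r v : inner g v 0 = 0.
Proof. by rewrite /inner trmx0 mulmx0 mxE. Qed.

Lemma innerC v w : g^T = g -> inner g v w = inner g w v.
Proof.
move=> gT; rewrite /inner -[in LHS](trmxK (_ *m _)) mxE !trmx_mul !trmxK gT.
by rewrite mulmxA.
Qed.

Hypothesis gpos : forall v, v != 0 -> 0 < inner g v v.

Lemma posdef_unitmx : g \in unitmx.
Proof.
rewrite unitmxE unitfE; apply/negP => /det0P[v v0 vg].
by have := gpos v0; rewrite /inner vg mul0mx mxE ltxx.
Qed.

(** An orthonormal family of fewer than n vectors is extended: by rank, some nonzero vector is
    orthogonal to all of them, and it is then normalized. *)
Lemma orthonormal_basis : g^T = g -> exists E : 'M[R]_n, E *m g *m E^T = 1%:M.
Proof.
move=> gT.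
suff: forall k, (k <= n)%N -> exists E : 'M[R]_(k, n), E *m g *m E^T = 1%:M.
  exact.
elim=> [_|k IH kn]; first by exists 0; apply/matrixP => - [].
have [E EgE] := IH (ltnW kn).
have : kermx (E *m g)^T != 0.
  rewrite -mxrank_eq0 mxrank_ker -lt0n subn_gt0.
  by rewrite (leq_ltn_trans _ kn)// rank_leq_col.
case/rowV0Pn => v /sub_kermxP; rewrite trmx_mul gT => vE v0.
pose w := (Num.sqrt (inner g v v))^-1 *: v.
have ww : w *m g *m w^T = 1%:M.
  rewrite [LHS]mx11_scalar; congr (_%:M).
  rewrite -/(inner g w w) innerZl innerC// innerZl mulrA -expr2 exprVn.
  by rewrite sqr_sqrtr ?mulVf ?gt_eqF ?gpos// ltW// gpos.
have wE : w *m g *m E^T = 0 by rewrite -mulmxA /w -scalemxAl vE scaler0.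
exists (col_mx w E : 'M[R]_(1 + k, n)).
change (col_mx w E *m g *m (col_mx w E)^T = 1%:M :> 'M[R]_(1 + k)).
rewrite tr_col_mx mul_col_mx mul_col_row ww wE EgE.
have -> : E *m g *m w^T = 0.
  by have := congr1 trmx wE; rewrite !trmx_mul trmxK gT trmx0 mulmxA.
by rewrite -scalar_mx_block.
Qed.

End Inner.

Section Volume.
Variables (R : realType) (g : 'M[R]_4).
Implicit Types a b c d : 'rV[R]_4.

(** Laplace expansion along the first two rows. Naming the entries by natural numbers turns the
    identities on [vol4] below into polynomial identities for [ring]. *)
Lemma det_rows4 a b c d :
  let k (v : 'rV[R]_4) i := v 0 (inord i) in
  let m2 (v w : 'rV[R]_4) i j := k v i * k w j - k v j * k w i in
  \det (\matrix_(i < 4, j < 4) (nth 0 [:: a; b; c; d] i) 0 j) =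
    m2 a b 0%N 1%N * m2 c d 2%N 3%N - m2 a b 0%N 2%N * m2 c d 1%N 3%N
  + m2 a b 0%N 3%N * m2 c d 1%N 2%N + m2 a b 1%N 2%N * m2 c d 0%N 3%N
  - m2 a b 1%N 3%N * m2 c d 0%N 2%N + m2 a b 2%N 3%N * m2 c d 0%N 1%N.
Proof.
move=> k m2.
have kE (v : 'rV[R]_4) i : v 0 i = k v i by rewrite /k inord_val.
rewrite (expand_det_row _ ord0) !big_ord_recl big_ord0 /cofactor.
rewrite !(expand_det_row _ ord0) !big_ord_recl !big_ord0 /cofactor.
rewrite !det22 !mxE !kE /m2 /=; ring.
Qed.

Lemma vol4Dl a b b' c d :
  vol4 g a (b + b') c d = vol4 g a b c d + vol4 g a b' c d.
Proof. by rewrite /vol4 !det_rows4 !mxE; ring. Qed.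

Lemma vol4Zl a b c d k : vol4 g a (k *: b) c d = k * vol4 g a b c d.
Proof. by rewrite /vol4 !det_rows4 !mxE; ring. Qed.

Lemma vol4_swap12 a b c d : vol4 g a c b d = - vol4 g a b c d.
Proof. by rewrite /vol4 !det_rows4; ring. Qed.

Lemma vol4_swap23 a b c d : vol4 g a b d c = - vol4 g a b c d.
Proof. by rewrite /vol4 !det_rows4; ring. Qed.

Lemma vol40l a c d : vol4 g a 0 c d = 0.
Proof. by rewrite -(scale0r 0) vol4Zl mul0r. Qed.

Lemma vol40m a b d : vol4 g a b 0 d = 0.
Proof. by rewrite vol4_swap12 vol40l oppr0. Qed.

Lemma vol4_sum a b c d :
  vol4 g a b c d = \sum_l b 0 l * vol4 g a (delta_mx 0 l) c d.
Proof.
rewrite {1}(row_sum_delta b); elim: (index_enum _) => [|l s IH].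
  by rewrite !big_nil vol40l.
by rewrite !big_cons vol4Dl vol4Zl IH.
Qed.

(** The first, third and last arguments are linearly dependent. This is the shape taken by u and by
    a vertical field along a vertical line. *)
Lemma vol4_dependent a b c k k' h l :
  vol4 g (k *: (a + h *: b)) b c (k' *: (a + h *: b) + l *: c) = 0.
Proof. by rewrite /vol4 !det_rows4 !mxE; ring. Qed.

Lemma vol4_same12 a b d : vol4 g a b b d = 0.
Proof. by rewrite /vol4 !det_rows4; ring. Qed.

Lemma vol4_same13 a b c : vol4 g a b c b = 0.
Proof. by rewrite /vol4 !det_rows4; ring. Qed.

Lemma vol4_same01 a c d : vol4 g a a c d = 0.
Proof. by rewrite /vol4 !det_rows4; ring. Qed.

Lemma vol4_cycle a b c d : vol4 g a c d b = vol4 g a b c d.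
Proof. by rewrite vol4_swap23 vol4_swap12 opprK. Qed.

End Volume.

Section Phi.
Variables (R : realType) (g : 'rV[R]_4 -> 'M[R]_4) (x u : 'rV[R]_4).
Implicit Types X Y Z : 'rV[R]_4 * 'rV[R]_4.

Lemma phi_swap12 X Y Z : phi g x u Y X Z = - phi g x u X Y Z.
Proof.
rewrite /phi /alpha /alpha2 /mu_wedge_beta /beta.
rewrite !(vol4_swap12 _ _ (vert g x u X)) !(vol4_swap12 _ _ (theta X) (theta Y)).
rewrite (vol4_swap12 _ _ (theta Z) (theta X)) (vol4_swap12 _ _ (theta Y)(theta Z)).
by ring.
Qed.

Lemma phi_swap23 X Y Z : phi g x u X Z Y = - phi g x u X Y Z.
Proof.
rewrite /phi /alpha /alpha2 /mu_wedge_beta /beta.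
rewrite (vol4_swap23 _ _ (vert g x u X)) (vol4_swap12 _ _ (theta X) (theta Y)).
rewrite (vol4_swap12 _ _ (theta Z) (theta X)) (vol4_swap12 _ _ (theta Y)(theta Z)).
by ring.
Qed.

Lemma sphere_metricC X Y : (g x)^T = g x ->
  sphere_metric g x u X Y = sphere_metric g x u Y X.
Proof.
move=> gT; rewrite /sphere_metric (innerC (theta X) (theta Y) gT).
by rewrite (innerC (vert g x u X) _ gT).
Qed.

(** Every term of mu /\ beta and of alpha_2 has two horizontal slots, so only alpha survives. *)
Lemma phi_vertical23 X Y Z : theta Y = 0 -> theta Z = 0 ->
  phi g x u X Y Z = vol4 (g x) u (vert g x u X) (vert g x u Y) (vert g x u Z).
Proof.
move=> Y0 Z0; rewrite /phi /mu_wedge_beta /beta /mu /alpha2 /alpha Y0 Z0.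
rewrite !inner0r !inner0l !vol40l !vol40m.
by rewrite !(mul0r, mulr0, subr0, addr0, add0r).
Qed.

Lemma phi_vertical3 X Y Z a b : theta X = a -> theta Y = b -> theta Z = 0 ->
  phi g x u X Y Z = vol4 (g x) u (vert g x u X) (vert g x u Y) (vert g x u Z)
  + (inner (g x) u a * inner (g x) b (vert g x u Z)
     - inner (g x) u b * inner (g x) a (vert g x u Z))
  - vol4 (g x) u a b (vert g x u Z).
Proof.
move=> Xa Yb Z0; rewrite /phi /mu_wedge_beta /beta /mu /alpha2 /alpha Xa Yb Z0.
rewrite !inner0r !inner0l !vol40l !vol40m.
by rewrite !(mul0r, subr0, addr0, sub0r) mulrN.
Qed.

End Phi.

(** * Levi-Civita connection *)

Section Closed.
Variables (R : realType) (n : nat).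

Lemma christoffelC (g : 'rV[R]_n -> 'M[R]_n) x i j k :
  (\forall y \near x, (g y)^T = g y) ->
  christoffel g x i j k = christoffel g x j i k.
Proof.
move=> gT; rewrite /christoffel; congr (_ * _); apply: eq_bigr => l _.
have -> : dmetric g x l i j = dmetric g x l j i.
  by apply: near_eq_derive; apply: filterS gT => y gy; rewrite -{1}gy mxE.
by ring.
Qed.

(** As [T] is alternating, the twelve Christoffel sums are indexed by the six pairs among a, b, c,
    d. Each pair occurs twice, with opposite signs once the symmetry of the Christoffel symbols is
    used. *)
Lemma parallel_closed (g : 'rV[R]_n -> 'M[R]_n)
    (T : 'rV[R]_n -> 'I_n -> 'I_n -> 'I_n -> R) x a b c d :
  (\forall y \near x, (g y)^T = g y) ->
  (forall i j k, T x j i k = - T x i j k) ->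
  (forall i j k, T x i k j = - T x i j k) ->
  (forall a b c d, covariant_derivative g T x a b c d = 0) ->
  partial a (fun y => T y b c d) x - partial b (fun y => T y a c d) x
  + partial c (fun y => T y a b d) x - partial d (fun y => T y a b c) x = 0.
Proof.
move=> gT T12 T23 dT.
pose S i j k l := \sum_m christoffel g x i j m * T x m k l.
have SC i j k l : S i j k l = S j i k l.
  by apply: eq_bigr => m _; rewrite christoffelC.
have SN i j k l : S i j l k = - S i j k l.
  by rewrite /S -sumrN; apply: eq_bigr => m _; rewrite T23 mulrN.
have dE i j k l : partial i (fun y => T y j k l) x =
    S i j k l - S i k j l + S i l j k.
  have := dT i j k l; rewrite /covariant_derivative -/(S i j k l).
  have -> : \sum_m christoffel g x i k m * T x j m l = - S i k j l.
    by rewrite /S -sumrN; apply: eq_bigr => m _; rewrite T12 mulrN.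
  have -> : \sum_m christoffel g x i l m * T x j k m = S i l j k.
    by apply: eq_bigr => m _; rewrite T23 T12 opprK.
  by move=> h; apply/eqP; rewrite -subr_eq0 -[X in _ == X]h; apply/eqP; ring.
rewrite !dE (SC b a) (SC c a) (SC d a) (SC c b) (SC d b) (SC d c).
by rewrite (SN a b d c) (SN a c d b) (SN a d c b); ring.
Qed.

End Closed.

Section Connection.
Variables (R : realType) (n : nat).
Implicit Types (g : 'rV[R]_n -> 'M[R]_n) (x v w : 'rV[R]_n).

(* With row vectors, nabla_e w = D_e w + w *m connection_mx g x e. *)
Definition connection_mx g x v : 'M[R]_n :=
  \matrix_(j, k) \sum_i v 0 i * christoffel g x i j k.

Lemma mul_connection_mxC g x v w : (\forall y \near x, (g y)^T = g y) ->
  v *m connection_mx g x w = w *m connection_mx g x v.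
Proof.
move=> gT; apply/rowP => k; rewrite !mxE.
under eq_bigr do rewrite mxE mulr_sumr.
rewrite exchange_big /=; apply: eq_bigr => i _; rewrite mxE mulr_sumr.
by apply: eq_bigr => j _; rewrite christoffelC//; ring.
Qed.

Lemma connection_mx0 g x : connection_mx g x 0 = 0.
Proof. by apply/matrixP => j k; rewrite !mxE big1// => i _; rewrite mxE mul0r. Qed.

(** This is nabla g = 0 in matrix form. *)
Lemma derive_metric g x v :
  (\forall y \near x, (g y)^T = g y) -> g x \in unitmx -> differentiable g x ->
  'D_v g x = connection_mx g x v *m g x + g x *m (connection_mx g x v)^T.
Proof.
move=> gT gu dg.
have [_ /(_ (fun=> fun=> fun=> erefl)) [_ gC]] := christoffel_levi_civita
  (christoffel g x) gT gu.
rewrite derive_partial//; apply/matrixP => i j; rewrite summxE.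
transitivity (\sum_k v 0 k * dmetric g x k i j).
  apply: eq_bigr => k _; rewrite mxE; congr (_ * _).
  by rewrite /dmetric /partial derive_mx_coord//; exact: diff_derivable.
rewrite !mxE.
under eq_bigr do rewrite gC mulrDr !mulr_sumr.
rewrite big_split/=; congr (_ + _); rewrite exchange_big/=; apply: eq_bigr => l _.
  by rewrite mxE mulr_suml; apply: eq_bigr => k _; rewrite mulrA.
by rewrite !mxE mulr_sumr; apply: eq_bigr => k _; ring.
Qed.

Lemma smooth_on_christoffel (W : set 'rV[R]_n) g i j k : open W ->
  smooth_on W g -> (forall x, W x -> g x \in unitmx) ->
  smooth_on W (fun x => christoffel g x i j k).
Proof.
move=> oW gW gu; apply: smooth_onZl => //; apply: smooth_on_sum => // l _.
have gijW p q : smooth_on W (fun x => g x p q : R) by exact: smooth_on_coord.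
have dW r p q : smooth_on W (fun x => dmetric g x r p q).
  exact: smooth_on_partial.
apply: smooth_onM => //; first exact: smooth_on_invmx.
apply: smooth_onD => //; first exact: smooth_onD.
apply: (eq_smooth_on oW _ (smooth_onZl (-1) oW (dW l i j))) => x _.
by rewrite mulN1r.
Qed.

End Connection.

Lemma vertE (R : realType) (g : 'rV[R]_4 -> 'M[R]_4) x u X :
  vert g x u X = X.2 + u *m connection_mx g x X.1.
Proof.
rewrite /vert; congr (_ + _); apply/rowP => k; rewrite !mxE exchange_big.
apply: eq_bigr => j _; rewrite mxE mulr_sumr; apply: eq_bigr => i _; ring.
Qed.

Lemma smooth_on_vol4 (R : realType) n (W : set 'rV[R]_n)
    (g : 'rV[R]_n -> 'M[R]_4) (a b c d : 'rV[R]_n -> 'rV[R]_4) : open W ->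
  smooth_on W g -> (forall x, W x -> 0 < \det (g x)) ->
  smooth_on W a -> smooth_on W b -> smooth_on W c -> smooth_on W d ->
  smooth_on W (fun x => vol4 (g x) (a x) (b x) (c x) (d x)).
Proof.
move=> oW gW g0 aW bW cW dW; apply: smooth_onM => //.
  apply: smooth_on_sqrt => //; apply: smooth_on_det => // i j.
  exact: smooth_on_coord.
apply: smooth_on_det => // i j.
case: i => [[|[|[|[|//]]]] hi].
- by apply: (eq_smooth_on oW _ (smooth_on_coord 0 j oW aW)) => x _; rewrite mxE.
- by apply: (eq_smooth_on oW _ (smooth_on_coord 0 j oW bW)) => x _; rewrite mxE.
- by apply: (eq_smooth_on oW _ (smooth_on_coord 0 j oW cW)) => x _; rewrite mxE.
- by apply: (eq_smooth_on oW _ (smooth_on_coord 0 j oW dW)) => x _; rewrite mxE.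
Qed.

(** Expanding [b] in the coordinate basis gives a sum of products whose first factor vanishes at x;
    only that factor has to be differentiated. *)
Lemma derive_vol4_root (R : realType) n (W : set 'rV[R]_n)
    (g : 'rV[R]_n -> 'M[R]_4) (a b c d : 'rV[R]_n -> 'rV[R]_4) x v : open W ->
  W x -> smooth_on W g -> (forall x, W x -> 0 < \det (g x)) ->
  smooth_on W a -> smooth_on W b -> smooth_on W c -> smooth_on W d ->
  b x = 0 ->
  'D_v (fun x => vol4 (g x) (a x) (b x) (c x) (d x)) x =
  vol4 (g x) (a x) ('D_v b x) (c x) (d x).
Proof.
move=> oW Wx gW g0 aW bW cW dW b0.
have db l : derivable (fun y => b y 0 l) x v.
  exact: (smooth_on_derivable (smooth_on_coord 0 l oW bW) Wx).
have dvol l : derivable (fun y => vol4 (g y) (a y) (delta_mx 0 l) (c y) (d y)) x v.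
  apply: (smooth_on_derivable (W := W)) => //; apply: smooth_on_vol4 => //.
  exact: smooth_on_cst.
rewrite (_ : (fun y => _) = \sum_l
  (fun y => b y 0 l * vol4 (g y) (a y) (delta_mx 0 l) (c y) (d y))); last first.
  by apply/funext => y; rewrite vol4_sum fct_sumE.
rewrite derive_sum => [|l]; last exact: derivableM.
rewrite [RHS]vol4_sum; apply: eq_bigr => l _.
rewrite deriveM_root// ?b0 ?mxE// derive_mx_coord//.
exact: smooth_on_derivable bW Wx.
Qed.

(** * A local parametrization of the unit tangent bundle *)

(* At t = 0 the first four coordinates of R^7 are horizontal and the last three
   vertical. *)
Definition hor_index (i : 'I_4) : 'I_7 := lshift 3 i.
Definition ver_index (k : 'I_3) : 'I_7 := rshift 4 k.

Section Chart.
Variables (R : realType) (W : set 'rV[R]_4) (G : 'rV[R]_4 -> 'M[R]_4).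
Hypothesis oW : open W.
Hypothesis GW : smooth_on W G.
Hypothesis GT : forall x, W x -> (G x)^T = G x.
Hypothesis G0 : forall x, W x -> forall v, v != 0 -> 0 < inner (G x) v v.
Variables (x0 : 'rV[R]_4) (E : 'M[R]_4).
Hypothesis Wx0 : W x0.
Hypothesis EGE : E *m G x0 *m E^T = 1%:M.

Let e0 : 'rV[R]_4 := row 0 E.
Let f (k : 'I_3) : 'rV[R]_4 := row (lift 0 k) E.

Definition horizontal_mx : 'M[R]_(7, 4) := col_mx E (0 : 'M[R]_(3, 4)).
Definition vertical_mx : 'M[R]_(7, 4) :=
  col_mx (0 : 'M[R]_(4, 4)) (\matrix_k row (lift 0 k) E : 'M[R]_(3, 4)).
Let X := horizontal_mx.
Let F := vertical_mx.

(* The covectors dual to the vectors of S_M are prescribed, up to normalization,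
   rather than the vectors themselves: then the functions <u, w>, for constant w,
   are affine up to the common factor param_scale.  The derivative B of the
   covector at t = 0 is such that the a-th coordinate field has horizontal part
   row a X and vertical part row a F. *)
Definition covector_mx : 'M[R]_(7, 4) := \matrix_a
  (row a F *m G x0 + e0 *m G x0 *m (connection_mx G x0 (row a X))^T).
Let B := covector_mx.

Definition param_point : 'rV[R]_7 -> 'rV[R]_4 := affine x0 X.
Definition param_covector : 'rV[R]_7 -> 'rV[R]_4 := affine (e0 *m G x0) B.
Let x := param_point.
Let l := param_covector.

(** The inverse Gram matrix is the dual metric on covectors, so this is the inverse of the norm of
    [l t]. *)
Definition param_scale (t : 'rV[R]_7) : R :=
  (Num.sqrt (inner (invmx (G (x t))) (l t) (l t)))^-1.
Let s := param_scale.

Definition param_vect (t : 'rV[R]_7) : 'rV[R]_4 := s t *: (l t *m invmx (G (x t))).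
Let u := param_vect.

(** Positivity of the covector on e_0 keeps it nonzero, so that it can be normalized. It also lets
    the scale factor be cancelled or recovered in [param_inj] and [param_immersion]. *)
Definition param_dom : set 'rV[R]_7 :=
  x @^-1` W `&` [set t | 0 < (l t *m e0^T) 0 0].
Let D := param_dom.

Let Gu y : W y -> G y \in unitmx.
Proof. by move=> Wy; apply: posdef_unitmx; exact: G0. Qed.

Let frame i j : inner (G x0) (row i E) (row j E) = (i == j)%:R.
Proof.
have := congr1 (fun A : 'M[R]_4 => A i j) EGE; rewrite [X in _ = X]mxE => <-.
by rewrite inner_row -!row_mul mxE.
Qed.

Let rowXl i : row (hor_index i) X = row i E.
Proof. exact: (rowKu i E 0). Qed.

Let rowXr k : row (ver_index k) X = 0.
Proof. by apply: etrans (rowKd k E 0) _; rewrite row0. Qed.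

Let rowFl i : row (hor_index i) F = 0.
Proof. by apply: etrans (rowKu i 0 _) _; rewrite row0. Qed.

Let rowFr k : row (ver_index k) F = f k.
Proof. by apply: etrans (rowKd k 0 _) _; rewrite rowK. Qed.

Let x00 : x 0 = x0.
Proof. by rewrite /x /param_point /affine mul0mx addr0. Qed.

Let l0 : l 0 = e0 *m G x0.
Proof. by rewrite /l /param_covector /affine mul0mx addr0. Qed.

Let coord_cont (w : 'rV[R]_4) : continuous (fun t => (l t *m w^T) 0 0).
Proof.
move=> t; apply: differentiable_continuous.
have : smooth_on setT (fun t => (l t *m w^T) 0 0).
  apply: smooth_on_coord; first exact: openT.
  apply: smooth_on_mulmx; first exact: openT.
    apply: smooth_on_affine.
  exact: smooth_on_cst.
by move/smooth_on_differentiable; apply.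
Qed.

Lemma open_param_dom : open D.
Proof.
apply: openI.
  by apply: open_comp => // t _; exact: continuous_affine.
apply: (@open_comp _ _ (fun t => (l t *m e0^T) 0 0) [set r : R | 0 < r]).
  by move=> t _; exact: coord_cont.
exact: open_gt.
Qed.
Let oD := open_param_dom.

Lemma param_dom0 : D 0.
Proof.
split; rewrite /= ?x00// l0; have := frame 0 0.
by rewrite /inner => ->.
Qed.

Let GxD : smooth_on D (fun t => G (x t)).
Proof.
apply: smooth_on_mx => // i j.
have h : smooth_on (x @^-1` W) (fun t => G (x t) i j : R).
  exact: (smooth_on_affine_comp (f := fun y => G y i j) oW
    (smooth_on_coord i j oW GW)).
by move=> p t [Wt _]; exact: h.
Qed.

Let iGxD : smooth_on D (fun t => invmx (G (x t))).
Proof.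
apply: smooth_on_mx => // i j; apply: smooth_on_invmx => //.
  by move=> t [Wt _]; exact: Gu.
by move=> p q; exact: smooth_on_coord.
Qed.

Let lD : smooth_on D l.
Proof. exact: smooth_on_affine. Qed.

Let norm2_gt0 t : D t -> 0 < inner (invmx (G (x t))) (l t) (l t).
Proof.
move=> [Wt lt0]; have Gt := Gu Wt.
pose w := l t *m invmx (G (x t)).
have lE : l t = w *m G (x t) by rewrite mulmxKV.
have w0 : w != 0.
  by apply/eqP => w0; move: lt0; rewrite /= lE w0 !mul0mx mxE ltxx.
have -> : inner (invmx (G (x t))) (l t) (l t) = inner (G (x t)) w w.
  by rewrite /inner -/w lE trmx_mul GT// mulmxA.
exact: G0.
Qed.

Let sD : smooth_on D s.
Proof.
apply: smooth_on_sqrtV => //; apply: smooth_on_coord => //.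
apply: smooth_on_mulmx => //; first exact: smooth_on_mulmx.
exact: smooth_on_trmx.
Qed.

Let s_gt0 t : D t -> 0 < s t.
Proof. by move=> Dt; rewrite invr_gt0 sqrtr_gt0 norm2_gt0. Qed.

Lemma smooth_on_param_vect : smooth_on D u.
Proof. by apply: smooth_on_scalemx => //; exact: smooth_on_mulmx. Qed.
Let uD := smooth_on_param_vect.

Let uG t : D t -> u t *m G (x t) = s t *: l t.
Proof. by move=> [Wt _]; rewrite -scalemxAl mulmxKV//; exact: Gu. Qed.

Let u0 : u 0 = e0.
Proof.
rewrite /u /param_vect x00 l0 mulmxK ?Gu// /s /param_scale x00 l0 /inner.
rewrite mulmxK ?Gu// trmx_mul GT//.
have -> : e0 *m (G x0 *m e0^T) = 1%:M.
  by rewrite mulmxA [LHS]mx11_scalar; have := frame 0 0; rewrite /inner => ->.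
by rewrite mxE/= sqrtr1 invr1 scale1r.
Qed.

Let s0 : s 0 = 1.
Proof.
rewrite /s /param_scale x00 l0 /inner mulmxK ?Gu// trmx_mul GT// mulmxA.
by have := frame 0 0; rewrite /inner => ->; rewrite sqrtr1 invr1.
Qed.

Lemma param_vect_unit t : D t -> inner (G (x t)) (u t) (u t) = 1.
Proof.
move=> Dt; have [Wt _] := Dt.
rewrite /inner uG// /u /param_vect linearZ/= trmx_mul -scalemxAl -scalemxAr.
rewrite trmx_inv GT// mulmxA 2!mxE mulrA -expr2 exprVn sqr_sqrtr.
  by rewrite mulVf// gt_eqF// norm2_gt0.
by rewrite ltW// norm2_gt0.
Qed.

Let lw (w : 'rV[R]_4) (t : 'rV[R]_7) : R := (l t *m w^T) 0 0.
Let Bw (d : 'rV[R]_7) (w : 'rV[R]_4) : R := (d *m B *m w^T) 0 0.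

Let lwD w : smooth_on D (lw w).
Proof.
apply: smooth_on_coord => //; apply: smooth_on_mulmx => //.
exact: smooth_on_cst.
Qed.

Let derive_lw w d t : 'D_d (lw w) t = Bw d w.
Proof.
rewrite /lw derive_mx_coord; last first.
  apply: derivable_mulmx; last exact: derivable_cst.
  exact/diff_derivable/differentiable_affine.
rewrite derive_mulmx; last exact: derivable_cst.
  by rewrite derive_cst mulmx0 addr0 derive_affine.
exact/diff_derivable/differentiable_affine.
Qed.

Let near_GT t : D t -> \forall y \near x t, (G y)^T = G y.
Proof.
move=> [Wt _]; apply: filterS (open_nbhs_nbhs (conj oW Wt)) => y; exact: GT.
Qed.

Let BwE a w : Bw (delta_mx 0 a) w =
  inner (G x0) (row a F) w +
  inner (G x0) e0 (w *m connection_mx G x0 (row a X)).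
Proof.
rewrite /Bw -rowE rowK mulmxDl mxE; congr (_ + _).
by rewrite /inner trmx_mul !mulmxA.
Qed.

Let E_unit : E \in unitmx.
Proof. by have [] := mulmx1_unit (etrans (mulmxA _ _ _) EGE). Qed.

(** As [E] is invertible, a direction that fixes the base point has no horizontal coordinates, and
    on the vertical ones the connection term of [B] is zero. *)
Let vertical_Bw d w : d *m X = 0 ->
  (forall i, d 0 (hor_index i) = 0) /\
  Bw d w = \sum_k d 0 (ver_index k) * inner (G x0) (f k) w.
Proof.
move=> dX.
have dh : lsubmx (d : 'rV[R]_(4 + 3)) = 0.
  have : lsubmx (d : 'rV[R]_(4 + 3)) *m E = 0.
    have <- : (d : 'rV[R]_(4 + 3)) *m col_mx E (0 : 'M[R]_(3, 4)) =
        lsubmx (d : 'rV[R]_(4 + 3)) *m E.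
      by rewrite -{1}(hsubmxK (d : 'rV[R]_(4 + 3))) mul_row_col mulmx0 addr0.
    exact: dX.
  by move=> /(congr1 (mulmx^~ (invmx E))); rewrite mulmxK// mul0mx.
have d0 i : d 0 (hor_index i) = 0.
  by have /rowP/(_ i) := dh; rewrite !mxE.
split=> //; rewrite /Bw [d *m B]mulmx_sum_row mulmx_suml summxE.
rewrite (@big_split_ord _ _ _ 4 3) /= big1 ?add0r => [|i _]; last first.
  by rewrite [d 0 _]d0 scale0r mul0mx mxE.
apply: eq_bigr => k _; rewrite -scalemxAl mxE; congr (_ * _).
rewrite -[rshift 4 k]/(ver_index k) rowK rowFr rowXr connection_mx0 trmx0.
by rewrite mulmx0 addr0.
Qed.

Let vertical_Bw0 d : d *m X = 0 -> Bw d e0 = 0.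
Proof.
move=> dX; have [_ ->] := vertical_Bw e0 dX; apply: big1 => k _.
by rewrite frame mulr0.
Qed.

Let vertical_Bwf d k : d *m X = 0 -> Bw d (f k) = d 0 (ver_index k).
Proof.
move=> dX; have [_ ->] := vertical_Bw (f k) dX.
rewrite (bigD1 k)//= frame eqxx mulr1 big1 ?addr0// => j jk.
by rewrite frame (inj_eq lift_inj) (negPf jk) mulr0.
Qed.

Let vertical_eq0 d : d *m X = 0 -> (forall k, Bw d (f k) = 0) -> d = 0.
Proof.
move=> dX df; apply/rowP => a; rewrite mxE.
have [dh _] := vertical_Bw 0 dX.
have [i|k] := splitP (a : 'I_(4 + 3)) => ak.
  by rewrite -(dh i); congr (d _ _); apply: val_inj.
rewrite -(df k) vertical_Bwf//; congr (d _ _); exact: val_inj.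
Qed.

Let inner_uE t w : D t -> inner (G (x t)) (u t) w = s t * lw w t.
Proof. by move=> Dt; rewrite /inner uG// -scalemxAl mxE. Qed.

Let derive_inner_u t d w : D t ->
  'D_d (fun t => inner (G (x t)) (u t) w) t = 'D_d s t * lw w t + s t * Bw d w.
Proof.
move=> Dt.
transitivity ('D_d (fun t => s t * lw w t) t).
  apply: near_eq_derive; apply: filterS (open_nbhs_nbhs (conj oD Dt)) => y Dy.
  exact: inner_uE.
rewrite deriveM; first last.
- exact: (smooth_on_derivable (lwD w) Dt).
- exact: (smooth_on_derivable sD Dt).
by rewrite derive_lw addrC /GRing.scale/= [X in X + _]mulrC.
Qed.

(** Metric compatibility for vector fields [a] and [b] along the map [x]; the vectors in parentheses
    are their covariant derivatives. *)
Let derive_inner (a b : 'rV[R]_7 -> 'rV[R]_4) t d : D t ->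
  smooth_on D a -> smooth_on D b ->
  'D_d (fun t => inner (G (x t)) (a t) (b t)) t =
  inner (G (x t)) ('D_d a t + a t *m connection_mx G (x t) (d *m X)) (b t) +
  inner (G (x t)) (a t) ('D_d b t + b t *m connection_mx G (x t) (d *m X)).
Proof.
move=> Dt aD bD; have [Wt _] := Dt.
have da : derivable a t d := smooth_on_derivable aD Dt.
have db : derivable b t d := smooth_on_derivable bD Dt.
have dG : derivable (fun t => G (x t)) t d := smooth_on_derivable GxD Dt.
have dGE : 'D_d (fun t => G (x t)) t = connection_mx G (x t) (d *m X) *m G (x t)
    + G (x t) *m (connection_mx G (x t) (d *m X))^T.
  rewrite derive_affine_comp derive_metric//; first exact: near_GT.
    exact: Gu.
  exact: smooth_on_differentiable GW Wt.
rewrite /inner derive_mx_coord; last first.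
  by apply: derivable_mulmx; [exact: derivable_mulmx|exact: derivable_trmx].
rewrite derive_mulmx; [|exact: derivable_mulmx|exact: derivable_trmx].
rewrite derive_mulmx// derive_trmx// dGE.
set C := connection_mx _ _ _; set da' := 'D_d a t; set db' := 'D_d b t.
transitivity (((da' + a t *m C) *m G (x t) *m (b t)^T +
  a t *m G (x t) *m (db' + b t *m C)^T) 0 0); last by rewrite mxE.
congr (fun_of_matrix _ 0 0).
rewrite [(db' + _)^T]linearD/= trmx_mul !(mulmxDl, mulmxDr) !mulmxA -!addrA.
by congr (_ + (_ + _)); rewrite addrC.
Qed.

(** Equal base points leave a vertical difference. The pairing of [l] with e_0 does not see it, so
    the scale factors agree; the pairings with the [f k] then recover the vertical coordinates. *)
Lemma param_inj t t' : D t -> D t' -> x t = x t' -> u t = u t' -> t = t'.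
Proof.
move=> Dt Dt' xtt' utt'.
have dX : (t - t') *m X = 0.
  by rewrite mulmxBl; apply/eqP; rewrite subr_eq0; apply/eqP; exact: addrI xtt'.
have slw w : s t * lw w t = s t' * lw w t'.
  by rewrite -!inner_uE// xtt' utt'.
have lwB w : lw w t - lw w t' = Bw (t - t') w.
  have -> : lw w t = lw w t' + Bw (t - t') w; last by rewrite addrC addKr.
  rewrite /lw (_ : l t = l t' + (t - t') *m B); first by rewrite mulmxDl mxE.
  by rewrite /l /param_covector /affine -addrA -mulmxDl subrKC.
have le0 : lw e0 t = lw e0 t'.
  by apply/eqP; rewrite -subr_eq0 lwB vertical_Bw0.
have st : s t = s t'.
  have := slw e0; rewrite le0 => /mulIf; apply.
  by rewrite gt_eqF//; case: Dt'.
apply/eqP; rewrite -subr_eq0; apply/eqP/vertical_eq0 => // k.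
rewrite -lwB; have := slw (f k); rewrite st => /mulfI -> //; first exact: subrr.
by rewrite gt_eqF// s_gt0.
Qed.

(** Infinitesimal form of the argument of [param_inj]: testing against e_0 kills the derivative of
    the scale factor, then testing against the [f k] kills the direction. *)
Lemma param_immersion t : D t -> row_free (row_mx ('J x t) ('J u t)).
Proof.
move=> Dt; rewrite -kermx_eq0; apply/rowV0P => d /sub_kermxP.
rewrite mul_mx_row -(row_mx0 _ _ 4 4) => /eq_row_mx[].
have dx : differentiable x t by exact: differentiable_affine.
move=> Jx Ju.
have dX := etrans (esym (derive_affine x0 X t d)) (etrans (deriveEjacobian d dx) Jx).
have du := etrans (deriveEjacobian d (smooth_on_differentiable uD Dt)) Ju.
have dLw w : 'D_d s t * lw w t + s t * Bw d w = 0.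
  rewrite -derive_inner_u// (derive_inner (b := fun=> w) _ Dt uD); last first.
    exact: smooth_on_cst.
  by rewrite dX connection_mx0 !mulmx0 !addr0 du derive_cst inner0l inner0r addr0.
have ds : 'D_d s t = 0.
  have /eqP := dLw e0; rewrite vertical_Bw0// mulr0 addr0 mulf_eq0.
  by case/orP => [/eqP//|]; rewrite gt_eqF//; case: Dt.
apply: vertical_eq0 => // k.
have /eqP := dLw (f k); rewrite ds mul0r add0r mulf_eq0.
by rewrite gt_eqF ?s_gt0// => /eqP.
Qed.

(** * Coordinate fields and their vertical parts *)

Definition param_field t (a : 'I_7) : 'rV[R]_4 * 'rV[R]_4 :=
  (partial a x t, partial a u t).

Definition param_vert a t : 'rV[R]_4 := vert G (x t) (u t) (param_field t a).
Let V := param_vert.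

Lemma theta_param_field t a : theta (param_field t a) = row a X.
Proof. by rewrite rowE; exact: derive_affine. Qed.

Let VE a t : V a t = 'D_(delta_mx 0 a) u t
  + u t *m connection_mx G (x t) (delta_mx 0 a *m X).
Proof.
rewrite /V /param_vert vertE/=; congr (_ + _ *m connection_mx _ _ _).
exact: derive_affine.
Qed.

Let VD a : smooth_on D (V a).
Proof.
have : smooth_on D (fun t => partial a u t
    + u t *m connection_mx G (x t) (delta_mx 0 a *m X)).
  apply: smooth_onD => //; first exact: smooth_on_partial.
  apply: smooth_on_mulmx => //; apply: smooth_on_mx => // j k.
  have h : smooth_on D (fun t => \sum_i ((delta_mx 0 a : 'rV[R]_7) *m X) 0 i *
      christoffel G (x t) i j k).
    apply: smooth_on_sum => // i _; apply: smooth_onZl => //.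
    have CW := smooth_on_christoffel i j k oW GW Gu.
    by move=> p t [Wt _]; exact: (smooth_on_affine_comp oW CW).
  by apply: (eq_smooth_on oD _ h) => t _; rewrite mxE.
by apply: eq_smooth_on => // t _; rewrite VE.
Qed.

(** Metric compatibility for u and the constant field w trades [V a] for the derivatives of <u, w>,
    which are explicit. *)
Let inner_VE a t w : D t -> inner (G (x t)) (V a t) w =
  'D_(delta_mx 0 a) (fun t => inner (G (x t)) (u t) w) t
  - inner (G (x t)) (u t) (w *m connection_mx G (x t) (delta_mx 0 a *m X)).
Proof.
move=> Dt; rewrite (derive_inner (b := fun=> w) _ Dt uD).
  by rewrite derive_cst add0r -VE addrK.
exact: smooth_on_cst.
Qed.

Let inner_Vu a t : D t -> inner (G (x t)) (V a t) (u t) = 0.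
Proof.
move=> Dt; have := derive_inner (delta_mx 0 a) Dt uD uD.
rewrite (_ : 'D__ _ t = 0); last first.
  rewrite -(derive_cst (1 : R) t (delta_mx 0 a)); apply: near_eq_derive.
  by apply: filterS (open_nbhs_nbhs (conj oD Dt)) => y Dy; exact: param_vect_unit.
rewrite -VE (innerC (u t)); last by case: Dt => Wt _; exact: GT.
move=> /esym/eqP; rewrite -mulr2n mulrn_eq0/= => /eqP ->//.
Qed.

(** Both sides are tested on the frame. Against [f k] the choice of [B] gives equality, the
    connection terms cancelling; against e_0 both sides are zero, the left one because u has
    constant norm. *)
Lemma param_vert0 a : V a 0 = row a F.
Proof.
apply/eqP; rewrite -subr_eq0; apply/eqP.
have D0 := param_dom0.
have EG : G x0 *m E^T \in unitmx by rewrite unitmx_mul unitmx_tr E_unit Gu.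
apply: (can_inj (mulmxK EG)); rewrite mul0mx; apply/rowP => j.
rewrite mulmxA -inner_row mxE innerDl -scaleN1r innerZl mulN1r.
apply/eqP; rewrite subr_eq0; apply/eqP.
have [k ->|->] := unliftP 0 j.
  rewrite -{1}x00 inner_VE// derive_inner_u// x00 s0 mul1r u0.
  rewrite /lw l0 -/(inner (G x0) e0 (f k)) frame mulr0 add0r BwE -rowE.
  by rewrite addrK.
rewrite -/e0 -{1}u0 -{1}x00 inner_Vu//.
have [i|k] := splitP (a : 'I_(4 + 3)) => aE.
  have -> : a = hor_index i by exact: val_inj.
  by rewrite rowFl inner0l.
have -> : a = ver_index k by exact: val_inj.
by rewrite rowFr frame.
Qed.

Let hor k := hor_index (lift 0 k).
Let dir (a : 'I_7) : 'rV[R]_7 := delta_mx 0 a.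

Let horX k : dir (hor k) *m X = f k.
Proof. by rewrite /dir -rowE rowXl. Qed.

Let verX k : dir (ver_index k) *m X = 0.
Proof. by rewrite /dir -rowE rowXr. Qed.

Let inner_inj v w : (forall z, inner (G x0) v z = inner (G x0) w z) -> v = w.
Proof.
move=> vw; apply/eqP; rewrite -subr_eq0; apply/negPn/negP => /(G0 Wx0).
by rewrite innerDl -scaleN1r innerZl vw mulN1r subrr ltxx.
Qed.

Let V_hor0 k : V (hor k) 0 = 0.
Proof. by rewrite param_vert0 rowFl. Qed.

Let V_ver0 k : V (ver_index k) 0 = f k.
Proof. by rewrite param_vert0 rowFr. Qed.

(** * Derivatives of phi at the origin *)

Definition param_phi a b c t : R :=
  phi G (x t) (u t) (param_field t a) (param_field t b) (param_field t c).

Lemma param_phi_hvv a j k t : param_phi a (ver_index j) (ver_index k) t =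
  vol4 (G (x t)) (u t) (V a t) (V (ver_index j) t) (V (ver_index k) t).
Proof. by apply: phi_vertical23; rewrite theta_param_field rowXr. Qed.

Lemma param_phi_hhv j k p t : param_phi (hor j) (hor k) (ver_index p) t =
  vol4 (G (x t)) (u t) (V (hor j) t) (V (hor k) t) (V (ver_index p) t)
  + (inner (G (x t)) (u t) (f j) * inner (G (x t)) (f k) (V (ver_index p) t)
     - inner (G (x t)) (u t) (f k) * inner (G (x t)) (f j) (V (ver_index p) t))
  - vol4 (G (x t)) (u t) (f j) (f k) (V (ver_index p) t).
Proof.
apply: phi_vertical3; rewrite theta_param_field; [exact: rowXl|exact: rowXl|].
exact: rowXr.
Qed.

Let detG t : D t -> 0 < \det (G (x t)).
Proof.
move=> [Wt _]; have [E' E'G] := orthonormal_basis (G0 Wt) (GT Wt).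
have := congr1 determinant E'G; rewrite !det_mulmx det_tr det1 => dE'.
have E'2 : \det E' ^+ 2 * \det (G (x t)) = 1 by rewrite -[RHS]dE'; ring.
have : 0 < \det E' ^+ 2 * \det (G (x t)) by rewrite E'2.
by rewrite pmulr_rgt0// lt_def sqr_ge0 andbT; apply/eqP => h;
  move: E'2; rewrite h mul0r => /esym/eqP; rewrite oner_eq0.
Qed.

Let D0 : D 0 := param_dom0.

(** Since [V (hor k)] vanishes at the origin, its derivative there is also its covariant derivative;
    antisymmetrizing over two horizontal directions produces the curvature. *)
Let derive_hvv v k i j :
  'D_v (param_phi (hor k) (ver_index i) (ver_index j)) 0 =
  vol4 (G x0) e0 ('D_v (V (hor k)) 0) (f i) (f j).
Proof.
rewrite (_ : param_phi _ _ _ = fun t => vol4 (G (x t)) (u t) (V (hor k) t)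
  (V (ver_index i) t) (V (ver_index j) t)); last first.
  by apply/funext => t; exact: param_phi_hvv.
rewrite (derive_vol4_root _ oD D0 GxD detG uD (VD _) (VD _) (VD _) (V_hor0 _)).
by rewrite x00 u0 !V_ver0.
Qed.

Section VerticalLine.
Variables (j k : 'I_3) (h : R).
Let t := h *: dir (ver_index j).

Let xt : x t = x0.
Proof.
by rewrite /x /param_point /affine -scalemxAl verX scaler0 addr0.
Qed.

Let lt w : lw w t = inner (G x0) (e0 + h *: f j) w.
Proof.
rewrite /lw /l /param_covector /affine mulmxDl mxE innerDl innerZl.
congr (_ + _); rewrite -!scalemxAl mxE; congr (_ * _).
rewrite -/(Bw _ w) BwE rowFr rowXr connection_mx0 mulmx0 inner0r addr0//.
Qed.

Let Dt : D t.
Proof.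
split; rewrite /= ?xt// -/(lw e0 t) lt innerDl innerZl !frame.
by rewrite mulr0 addr0.
Qed.

Let ut : u t = s t *: (e0 + h *: f j).
Proof. by apply: inner_inj => w; rewrite innerZl -lt -inner_uE// xt. Qed.

Let Vt : V (ver_index k) t =
  'D_(dir (ver_index k)) s t *: (e0 + h *: f j) + s t *: f k.
Proof.
apply: inner_inj => w; rewrite -{1}xt inner_VE// derive_inner_u//.
rewrite -/(dir _) verX connection_mx0 mulmx0 inner0r subr0 lt.
by rewrite BwE rowFr rowXr connection_mx0 mulmx0 inner0r addr0 !(innerDl, innerZl).
Qed.

Lemma vol4_vertical_line :
  vol4 (G (x t)) (u t) (f j) (f k) (V (ver_index k) t) = 0.
Proof. by rewrite ut Vt vol4_dependent. Qed.

Lemma vol4_vertical_line_swap :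
  vol4 (G (x t)) (u t) (f k) (f j) (V (ver_index k) t) = 0.
Proof. by rewrite vol4_swap12 vol4_vertical_line oppr0. Qed.

End VerticalLine.

Let derive_inner_u0 a k : 'D_(dir a) (fun t => inner (G (x t)) (u t) (f k)) 0 =
  Bw (dir a) (f k).
Proof.
rewrite derive_inner_u// s0 mul1r /lw l0 -/(inner (G x0) e0 (f k)) frame.
by rewrite mulr0 add0r.
Qed.

Let smooth_inner (a b : 'rV[R]_7 -> 'rV[R]_4) : smooth_on D a -> smooth_on D b ->
  smooth_on D (fun t => inner (G (x t)) (a t) (b t)).
Proof.
move=> aD bD; apply: smooth_on_coord => //; apply: smooth_on_mulmx => //.
  exact: smooth_on_mulmx.
exact: smooth_on_trmx.
Qed.

(** The alpha term has two arguments vanishing at the origin and the alpha_2 term is zero on the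
    line. In mu /\ beta only <u, f j> and <u, f k> get differentiated, whence the Kronecker
    symbols. *)
Let derive_hhv j k p q :
  (forall h, let t := h *: dir (ver_index p) in
    vol4 (G (x t)) (u t) (f j) (f k) (V (ver_index q) t) = 0) ->
  'D_(dir (ver_index p)) (param_phi (hor j) (hor k) (ver_index q)) 0 =
  (j == p)%:R * (k == q)%:R - (k == p)%:R * (j == q)%:R.
Proof.
move=> vol_line; set v := dir _.
have cD w : smooth_on D (fun=> w : 'rV[R]_4) by exact: smooth_on_cst.
rewrite (_ : param_phi _ _ _ = fun t =>
  vol4 (G (x t)) (u t) (V (hor j) t) (V (hor k) t) (V (ver_index q) t)
  + (inner (G (x t)) (u t) (f j) * inner (G (x t)) (f k) (V (ver_index q) t)
     - inner (G (x t)) (u t) (f k) * inner (G (x t)) (f j) (V (ver_index q) t))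
  - vol4 (G (x t)) (u t) (f j) (f k) (V (ver_index q) t)); last first.
  by apply/funext => t; exact: param_phi_hhv.
have uf i : derivable (fun t => inner (G (x t)) (u t) (f i)) 0 v.
  exact: (smooth_on_derivable (smooth_inner uD (cD _)) D0).
have fV i : derivable (fun t => inner (G (x t)) (f i) (V (ver_index q) t)) 0 v.
  exact: (smooth_on_derivable (smooth_inner (cD _) (VD _)) D0).
have u0f i : inner (G (x 0)) (u 0) (f i) = 0 by rewrite x00 u0 frame.
have dvol1 : derivable (fun t => vol4 (G (x t)) (u t) (V (hor j) t)
    (V (hor k) t) (V (ver_index q) t)) 0 v.
  by apply: (smooth_on_derivable (W := D)) => //; exact: smooth_on_vol4.
have dvol2 : derivable (fun t => vol4 (G (x t)) (u t) (f j)
    (f k) (V (ver_index q) t)) 0 v.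
  by apply: (smooth_on_derivable (W := D)) => //; exact: smooth_on_vol4.
rewrite (derive_sub_roots dvol1 (uf j) (fV k) (uf k) (fV j) dvol2)//.
rewrite (derive_vol4_root _ oD D0 GxD detG uD (VD _) (VD _) (VD _) (V_hor0 _)).
rewrite V_hor0 vol40m add0r !derive_inner_u0 !vertical_Bwf ?verX//.
rewrite (eq_derive_line (f' := fun=> 0)); last first.
  by move=> h; rewrite addr0 vol_line.
have verE i : v 0 (ver_index i) = (i == p)%:R.
  by rewrite mxE eqxx (inj_eq (@rshift_inj 4 3)).
have innerE i : inner (G (x 0)) (f i) (V (ver_index q) 0) = (i == q)%:R.
  by rewrite x00 V_ver0 frame (inj_eq lift_inj).
by rewrite derive_cst subr0 !innerE !verE.
Qed.

(** * Curvature terms and their cyclic sum *)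

Let sigma k : R := 'D_(dir (hor k)) s 0.

Let derive_V_hor a k w : inner (G x0) ('D_(dir a) (V (hor k)) 0) w =
  'D_(dir a) (fun t => inner (G (x t)) (V (hor k) t) w) 0.
Proof.
rewrite (derive_inner (b := fun=> w) _ D0 (VD _)); last exact: smooth_on_cst.
by rewrite V_hor0 mul0mx addr0 inner0l addr0 x00.
Qed.

(** On horizontal directions [B] reduces to its connection term, which is symmetric because the
    connection is torsion-free. *)
Let Bsym p q : Bw (dir (hor p)) (f q) = Bw (dir (hor q)) (f p).
Proof.
rewrite !BwE !rowFl !rowXl !inner0l !add0r; congr (inner _ _ _).
by apply: mul_connection_mxC; rewrite -x00; exact: near_GT.
Qed.

(* The first Bianchi identity, in the guise of the symmetry of the second
   derivatives of the functions <u, f i>. *)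
Let curl_V i j k :
  inner (G x0) ('D_(dir (hor j)) (V (hor k)) 0) (f i) -
  inner (G x0) ('D_(dir (hor j)) (V (hor i)) 0) (f k) =
  sigma k * Bw (dir (hor j)) (f i) - sigma i * Bw (dir (hor j)) (f k).
Proof.
have VfE p q t : D t -> inner (G (x t)) (V (hor p) t) (f q) =
    'D_(dir (hor p)) s t * lw (f q) t + s t * Bw (dir (hor p)) (f q)
    - inner (G (x t)) (u t) (f q *m connection_mx G (x t) (f p)).
  by move=> Dt; rewrite inner_VE// derive_inner_u// horX.
have dV p q : derivable (fun t => inner (G (x t)) (V (hor p) t) (f q)) 0
    (dir (hor j)).
  apply: (smooth_on_derivable (W := D)) => //; apply: smooth_inner => //.
  exact: smooth_on_cst.
apply: etrans (congr2 (fun b c => b - c) (derive_V_hor _ _ _)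
  (derive_V_hor _ _ _)) _.
apply: etrans (esym (deriveB (dV k i) (dV i k))) _.
pose S p := fun t => 'D_(dir (hor p)) s t.
transitivity ('D_(dir (hor j)) (fun t => lw (f i) t * S k t - lw (f k) t * S i t) 0).
  apply: near_eq_derive; apply: filterS (open_nbhs_nbhs (conj oD D0)) => t Dt.
  apply: etrans (congr2 (fun b c => b - c) (VfE k i t Dt) (VfE i k t Dt)) _.
  (* The connection term and the [B] term are symmetric in i and k and drop out; what remains
     carries a factor [lw (f i)] or [lw (f k)], zero at the origin. *)
  rewrite (mul_connection_mxC _ _ (near_GT Dt)) (Bsym k i) /S.
  move: (Bw _ _) (inner _ _ _) ('D_(dir (hor k)) s t) ('D_(dir (hor i)) s t).
  by move: (s t) (lw (f i) t) (lw (f k) t) => *; ring.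
have dl p : derivable (lw (f p)) 0 (dir (hor j)).
  exact: (smooth_on_derivable (lwD _) D0).
have dS p : derivable (S p) 0 (dir (hor j)).
  exact: (smooth_on_derivable (smooth_on_partial (hor p) sD) D0).
have l0f p : lw (f p) 0 = 0 by rewrite /lw l0 -/(inner (G x0) e0 (f p)) frame.
apply: etrans (deriveB (derivableM (dl i) (dS k)) (derivableM (dl k) (dS i))) _.
congr (_ - _); rewrite [RHS]mulrC.
  by rewrite -(derive_lw _ _ 0); exact: (deriveM_root (dl i) (dS k) (l0f i)).
by rewrite -(derive_lw _ _ 0); exact: (deriveM_root (dl k) (dS i) (l0f k)).
Qed.

Let i0 : 'I_3 := ord0.
Let i1 : 'I_3 := lift ord0 ord0.
Let i2 : 'I_3 := lift ord0 (lift ord0 ord0).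
(** The basis [E] is orthonormal but not chosen direct: this number is 1 or -1, and it enters only
    as a factor common to the three curvature terms. *)
Let vol0 := vol4 (G x0) e0 (f i0) (f i1) (f i2).

Let frame_expansion z : z = inner (G x0) z e0 *: e0 +
  (inner (G x0) z (f i0) *: f i0 + (inner (G x0) z (f i1) *: f i1 +
  inner (G x0) z (f i2) *: f i2)).
Proof.
have GE : G x0 *m E^T *m E = 1%:M by apply: mulmx1C; rewrite mulmxA.
rewrite -{1}[z]mulmx1 -GE !mulmxA mulmx_sum_row !big_ord_recl big_ord0 addr0.
by rewrite -!inner_row.
Qed.

Let vol_frame0 z : vol4 (G x0) e0 z (f i1) (f i2) = inner (G x0) z (f i0) * vol0.
Proof.
rewrite {1}(frame_expansion z) !vol4Dl !vol4Zl.
by rewrite vol4_same01 vol4_same12 vol4_same13 !mulr0 !addr0 add0r.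
Qed.

Let vol_frame1 z : vol4 (G x0) e0 z (f i2) (f i0) = inner (G x0) z (f i1) * vol0.
Proof.
rewrite {1}(frame_expansion z) !vol4Dl !vol4Zl.
rewrite vol4_same01 vol4_same12 vol4_same13 !mulr0 !addr0 !add0r.
by congr (_ * _); exact: vol4_cycle.
Qed.

Let vol_frame2 z : vol4 (G x0) e0 z (f i0) (f i1) = inner (G x0) z (f i2) * vol0.
Proof.
rewrite {1}(frame_expansion z) !vol4Dl !vol4Zl.
rewrite vol4_same01 vol4_same12 vol4_same13 !mulr0 !add0r.
by congr (_ * _); exact/esym/vol4_cycle.
Qed.

Lemma param_phi_not_closed : ~ (forall a b c d : 'I_7,
  partial a (param_phi b c d) 0 - partial b (param_phi a c d) 0
  + partial c (param_phi a b d) 0 - partial d (param_phi a b c) 0 = 0).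
Proof.
move=> closed.
(* The two vertical derivatives given by [derive_hhv] are 1 and -1, and their difference is the
   constant 2. *)
have calc (a b : R) : a - b + (true%:R * true%:R - false%:R * false%:R)
    - (false%:R * false%:R - true%:R * true%:R) = 0 -> a - b + 2 = 0.
  by move=> <- /=; ring.
have dphi j k : j != k ->
    vol4 (G x0) e0 ('D_(dir (hor j)) (V (hor k)) 0) (f j) (f k) -
    vol4 (G x0) e0 ('D_(dir (hor k)) (V (hor j)) 0) (f j) (f k) + 2 = 0.
  move=> jk; have E1 := derive_hvv (dir (hor j)) k j k.
  have E2 := derive_hvv (dir (hor k)) j j k.
  have E3 := derive_hhv (vol4_vertical_line j k).
  have E4 := derive_hhv (vol4_vertical_line_swap k j).
  have := etrans (esym (congr2 (fun b c => b - c) (congr2 (fun b c => b + c)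
    (congr2 (fun b c => b - c) E1 E2) E3) E4)) (closed _ _ _ _).
  rewrite !eqxx (eq_sym k j) (negPf jk); exact: calc.
pose P j k i := inner (G x0) ('D_(dir (hor j)) (V (hor k)) 0) (f i).
have P0 : (P i1 i2 i0 - P i2 i1 i0) * vol0 + 2 = 0.
  apply: etrans (dphi i1 i2 isT); rewrite mulrBl.
  by congr (_ - _ + _); exact/esym/vol_frame0.
have P1 : (P i2 i0 i1 - P i0 i2 i1) * vol0 + 2 = 0.
  apply: etrans (dphi i2 i0 isT); rewrite mulrBl.
  by congr (_ - _ + _); exact/esym/vol_frame1.
have P2 : (P i0 i1 i2 - P i1 i0 i2) * vol0 + 2 = 0.
  apply: etrans (dphi i0 i1 isT); rewrite mulrBl.
  by congr (_ - _ + _); exact/esym/vol_frame2.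
pose b p q := Bw (dir (hor p)) (f q).
(* The six terms of the cyclic sum are paired anew, by their common first index, so that [curl_V]
   applies. *)
have c0 : P i1 i2 i0 - P i1 i0 i2 = sigma i2 * b i1 i0 - sigma i0 * b i1 i2.
  exact: curl_V.
have c1 : P i2 i0 i1 - P i2 i1 i0 = sigma i0 * b i2 i1 - sigma i1 * b i2 i0.
  exact: curl_V.
have c2 : P i0 i1 i2 - P i0 i2 i1 = sigma i1 * b i0 i2 - sigma i2 * b i0 i1.
  exact: curl_V.
have b10 : b i1 i0 = b i0 i1 by exact: Bsym.
have b20 : b i2 i0 = b i0 i2 by exact: Bsym.
have b21 : b i2 i1 = b i1 i2 by exact: Bsym.
clearbody P b vol0; move: (sigma i0) (sigma i1) (sigma i2) c0 c1 c2.
rewrite b10 b20 b21 => r0 r1 r2 c0 c1 c2.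
(* The right-hand sides of c0, c1 and c2 cancel by the symmetry of [b]. Adding P0, P1 and P2 then
   leaves 6 = 0. *)
have : (P i1 i2 i0 - P i1 i0 i2 + (P i2 i0 i1 - P i2 i1 i0)
    + (P i0 i1 i2 - P i0 i2 i1)) * vol0 = 0 by rewrite c0 c1 c2; ring.
by move: P0 P1 P2; lra.
Qed.

End Chart.

Theorem corollary3p1 (R : realType) (M : topologicalType)
  (M_hausdorff : hausdorff_space M) (M_countable : @second_countable M)
  (M_nonempty : [set: M] !=set0)
  (A : oriented_atlas R 4 M) (g : riemannian_metric A) :
  ~ sphere_bundle_is_G2_manifold g.
Proof.
move=> G2; have [p _] := M_nonempty; have [i ip] := atlas_cover A p.
have [_ oW _ _ _] := atlas_chartP i.
pose G := metric_mx g i; pose x0 := chart_map (atlas_chart i) p.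
have Wx0 : chart_img (atlas_chart i) x0 by exists p.
have GW : smooth_on (chart_img (atlas_chart i)) G by exact: metric_smooth.
have GT x : chart_img (atlas_chart i) x -> (G x)^T = G x.
  exact: Defs.metric_sym.
have G0 x : chart_img (atlas_chart i) x -> forall v, v != 0 -> 0 < inner (G x) v v.
  move=> Wx v; exact: (metric_posdef g Wx).
have [E EGE] := orthonormal_basis (G0 x0 Wx0) (GT x0 Wx0).
pose D := param_dom (chart_img (atlas_chart i)) G x0 E.
have oD : open D by exact: open_param_dom.
have D0 : D 0 by exact: param_dom0.
have xD : smooth_on D (param_point x0 E) by exact: smooth_on_affine.
have uD : smooth_on D (param_vect G x0 E) by exact: smooth_on_param_vect.
pose P : sphere_param g := @SphereParam R M A g i D (param_point x0 E)
  (param_vect G x0 E) oD xD uD (fun t Dt => Dt.1)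
  (fun t Dt => param_vect_unit GT G0 Dt)
  (fun t t' Dt Dt' => param_inj GT G0 EGE Dt Dt')
  (fun t Dt => param_immersion oW GW GT G0 EGE Dt).
apply: (param_phi_not_closed oW GW GT G0 Wx0 EGE) => a b c d.
(* By construction of [P], the components [sp_phi P] are [param_phi] by mere unfolding. *)
apply: (@parallel_closed _ _ (sp_metric P) (sp_phi P)).
- apply: filterS (open_nbhs_nbhs (conj oD D0)) => t [Wt _].
  apply/matrixP => j k; rewrite !mxE; apply: sphere_metricC.
  by rewrite (GT _ Wt).
- by move=> j k l; exact: phi_swap12.
- by move=> j k l; exact: phi_swap23.
- exact: G2 P 0 D0.
Qed.
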